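(* Let $s\ge 0$. Let $P(\partial_t,\partial_z)=\sum_{(j,r)\in\Lambda}a_{jr}(t,z)\partial_t^j\partial_z^r$ be a partial differential operator with $\Lambda\subset\mathbb{N}_0\times\mathbb{N}_0$ finite and coefficients $a_{jr}(t,z)\in\mathcal{O}[[t]]$, and assume that $m:=\max_{(j,r)\in\Lambda}(j-\mathrm{ord}_t(a_{jr}))\ge 0$. Let $l$, $\tilde P_m(n,\partial_z)$ and $W_{m,l}(n,k,z)$ be associated with $P(\partial_t,\partial_z)$ as in the context. Consider the conditions: (a) For every $n\in\mathbb{N}_0$ the lower ordinate of the Newton polygon $N(\tilde P_m(n,\partial_z))$ is $l$, and $l$ is equal to zero. (b) The first positive slope of the Newton polygon $N(\tilde P_m(n,\partial_z))$ is greater than or equal to $1/s$ for every $n\in\mathbb{N}_0$. (c) The non-resonance condition $W_{m,l}(n,k,0)\neq0$ holds for every $n,k\in\mathbb{N}_0$. If (a), (b) and (c) hold, then the operator $P(\partial_t,\partial_z)\partial_t^{-m}$ is a linear automorphism on $\mathbb{C}[[t,z]]$ which extends to an automorphism on $\mathbb{C}[[z]]_s[[t]]$. Conversely, if the operator $P(\partial_t,\partial_z)\partial_t^{-m}$ is a linear automorphism on $\mathbb{C}[[t,z]]$ which extends to an automorphism on $\mathbb{C}[[z]]_s[[t]]$, and one of the conditions (a) or (c) is true, then all conditions (a), (b) and (c) are satisfied.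
   Context: $\mathbb{N}_0=\{0,1,2,\dots\}$. $\mathcal{O}[[t]]$ is the set of formal power series in $t$ whose coefficients are holomorphic functions of $z$ on some common neighborhood of the origin. $\mathbb{C}[[z]]_s$ is the space of Gevrey series of order $s$: all $\sum_{n\ge0}\varphi_nz^n\in\mathbb{C}[[z]]$ for which there are $C,A>0$ with $|\varphi_n|\le CA^n\Gamma(1+sn)$ for all $n\ge0$; $\mathbb{C}[[z]]_s[[t]]\subset\mathbb{C}[[t,z]]$ is the space of formal power series in $t$ with coefficients in $\mathbb{C}[[z]]_s$. ''A linear automorphism on $\mathbb{C}[[t,z]]$ extends to an automorphism on $\mathbb{C}[[z]]_s[[t]]$'' means that its restriction to $\mathbb{C}[[z]]_s[[t]]$ is a linear automorphism of $\mathbb{C}[[z]]_s[[t]]$. The coefficients $a_{jr}$, $(j,r)\in\Lambda$, are nonzero ($\Lambda$ nonempty), and are written $a_{jr}(t,z)=\sum_{n\ge \mathrm{ord}_t(a_{jr})}a_{j,r,n}(z)t^n$, where $\mathrm{ord}_t(a_{jr})$ is the order of the zero of $a_{jr}$ in $t$ at $t=0$. The operator $\partial_t^{-1}$ is $\partial_t^{-1}u(t)=\int_0^t u(\tau)\,d\tau$ (termwise on formal power series), and $\partial_t^{-m}$ is its $m$-th iterate. Put $\Lambda_m:=\{(j,r)\in\Lambda: j-\mathrm{ord}_t(a_{jr})=m\}$ (so $j\ge m$ for $(j,r)\in\Lambda_m$). For $(j,r)\in\Lambda_m$ write $a_{j,r,j-m}(z)=z^{\alpha_{j,r}}\tilde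 a_{j,r,j-m}(z)$ with $\alpha_{j,r}=\mathrm{ord}_z(a_{j,r,j-m}(z))$ (so $\tilde a_{j,r,j-m}(0)\ne0$). For $n\in\mathbb{N}_0$ define $$\tilde P_m(n,\partial_z)=\sum_{(j,r)\in\Lambda_m}\tilde a_{j,r,j-m}(z)z^{\alpha_{j,r}}\,n(n-1)\cdots(n-(j-m)+1)\,\partial_z^r ,$$ $$l:=\min_{(j,r)\in\Lambda_m}(\alpha_{j,r}-r),\qquad \Lambda_{m,l}:=\{(j,r)\in\Lambda_m:\alpha_{j,r}-r=l\},$$ $$W_{m,l}(n,k,z)=\sum_{(j,r)\in\Lambda_{m,l}}\tilde a_{j,r,j-m}(z)\,n(n-1)\cdots(n-(j-m)+1)\,k(k-1)\cdots(k-r+1),$$ where empty products equal $1$. For a one-variable operator $R(\partial_z)=\sum_{j\in\Gamma}b_j(z)\partial_z^j$ (terms with the same power of $\partial_z$ collected, $\Gamma\subset\mathbb{N}_0$ finite, all $b_j\neq0$), its Newton polygon is $N(R)=\mathrm{conv}\{\bigcup_{j\in\Gamma}Q(j,\mathrm{ord}_z(b_j)-j)\}$, where $Q(a,b)=\{(x,y)\in\mathbb{R}^2:x\le a,\ y\ge b\}$, and its lower ordinate is $\min_{j\in\Gamma}(\mathrm{ord}_z(b_j)-j)$. (For the zero operator there is no lower ordinate, so it is not equal to any integer.) The first positive slope of $N(R)$ is the smallest slope among the non-vertical boundary edges of $N(R)$ having positive slope; if there are none, it is taken to be $+\infty$. For $s=0$, $1/s:=+\infty$. *)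

(* Defs.v *)
From HB Require Import structures.
From mathcomp Require Import all_boot all_order all_algebra finmap complex.
From mathcomp Require Import all_classical all_reals all_analysis.

Set Implicit Arguments.
Unset Strict Implicit.
Unset Printing Implicit Defensive.

Import Order.TTheory GRing.Theory Num.Theory.
Import numFieldNormedType.Exports.

Local Open Scope classical_set_scope.
Local Open Scope ring_scope.
Local Open Scope complex_scope.

(* [u : fps R] is the series \sum_k u k z^k of C[[z]] and [u : fps2 R] the
   series \sum_(n, k) u n k t^n z^k of C[[t,z]].  The linear structure is the
   pointwise one of the function spaces; the product of C[[t,z]] is [mul_fps]. *)
Notation fps R := (nat -> R[i]^o).
Notation fps2 R := (nat -> nat -> R[i]^o).

(* The order of a series; the value on the zero series is a junk value. *)
Definition ord (V : nmodType) (u : nat -> V) : nat :=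
  if pselect (exists n, `[< u n <> 0 >]) is left h then ex_minn h else 0%N.

Section Operators.
Variable R : realType.

Definition dt (u : fps2 R) : fps2 R := fun n => n.+1%:R *: u n.+1.

Definition dz (u : fps2 R) : fps2 R := fun n k => k.+1%:R * u n k.+1.

Definition intt (u : fps2 R) : fps2 R :=
  fun n => if n is n'.+1 then n'.+1%:R^-1 *: u n' else 0.

Definition mul_fps (a u : fps2 R) : fps2 R := fun n k =>
  \sum_(i < n.+1) \sum_(j < k.+1) a i j * u (n - i)%N (k - j)%N.

(* P(\partial_t, \partial_z), with coefficients a j r for (j, r) in Lambda. *)
Definition pdo (Lambda : {fset nat * nat}) (a : nat -> nat -> fps2 R)
    (u : fps2 R) : fps2 R :=
  \sum_(p <- Lambda) mul_fps (a p.1 p.2) (iter p.1 dt (iter p.2 dz u)).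

End Operators.

Section Spaces.
Variable R : realType.

(* The elements of O[[t]], seen in C[[t,z]]: the coefficients of the powers of
   t are the Taylor expansions at 0 of functions that are holomorphic on a
   common open neighborhood U of 0. *)
Definition holo_fps : set (fps2 R) := [set a |
  exists2 U : set R[i]^o, open U /\ U 0 &
  exists f : nat -> R[i]^o -> R[i]^o, forall n,
    (forall z, U z -> derivable (f n) z 1) /\
    \forall z \near (0 : R[i]^o),
      series (fun k => a n k * z ^+ k : R[i]^o) @ \oo --> f n z].

Definition Gamma (x : R) : R :=
  \int[lebesgue_measure]_(y in `]0, +oo[) (y `^ (x - 1) * expR (- y)).

Definition gevrey (s : R) : set (fps R) := [set u |
  exists B A : R, [/\ 0 < B, 0 < A &
    forall n, `|u n| <= (B * A ^+ n * Gamma (1 + s * n%:R))%:C]].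

Definition gevrey_t (s : R) : set (fps2 R) := [set u | forall n, gevrey s (u n)].

End Spaces.

(* T restricts to a linear automorphism of the subspace E. *)
Definition linear_automorphism_on (K : pzRingType) (V : lmodType K) (E : set V)
    (T : V -> V) : Prop :=
  (forall c u v, E u -> E v -> T (c *: u + v) = c *: T u + T v) /\
  set_bij E E T.

(* The family [b : nat -> fps R], of finite support, is the one-variable
   operator \sum_j b_j(z) \partial_z^j. *)
Section NewtonPolygon.
Variable R : realType.
Implicit Types (b : nat -> fps R) (N : set (R^o * R^o)%type).

Definition op_supp b : set nat := [set j | b j <> 0].

Definition op_height b (j : nat) : int := (ord (b j))%:Z - j%:Z.

Definition quadrant (x y : R) : set (R^o * R^o)%type :=
  [set v | v.1 <= x /\ y <= v.2].

Definition newton_polygon b : set (R^o * R^o)%type :=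
  smallest (@convex_set R (R^o * R^o)%type)
    (\bigcup_(j in op_supp b) quadrant j%:R (op_height b j)%:~R).

(* l is the lower ordinate of the Newton polygon of b; there is no such l if
   b is the zero operator. *)
Definition is_lower_ordinate b (l : int) : Prop :=
  ([set op_height b j | j in op_supp b] `&`
   lbound [set op_height b j | j in op_supp b]) l.

(* The slopes of the non-vertical edges of N: an edge is a nondegenerate
   intersection of N with a supporting line, so the line through two distinct
   points of N carries an edge iff N lies on one side of it. *)
Definition edge_slope N : set R := [set sigma |
  exists p q, [/\ N p, N q, p.1 < q.1, q.2 = p.2 + sigma * (q.1 - p.1) &
    (forall v, N v -> p.2 + sigma * (v.1 - p.1) <= v.2) \/
    (forall v, N v -> v.2 <= p.2 + sigma * (v.1 - p.1))]].

(* N has finitely many edges, hence the infimum is a minimum, or +oo if there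
   is no positive slope. *)
Definition first_positive_slope N : \bar R :=
  ereal_inf [set sigma%:E | sigma in edge_slope N `&` [set x | 0 < x]].

Definition inv_order (s : R) : \bar R := if s == 0 then +oo%E else s^-1%:E.

End NewtonPolygon.

Section PrincipalPart.
Variable R : realType.
Variables (Lambda : {fset nat * nat}) (a : nat -> nat -> fps2 R).

Definition weight (p : nat * nat) : int := p.1%:Z - (ord (a p.1 p.2))%:Z.

Definition is_max_weight (m : int) : Prop :=
  ([set weight p | p in [set` Lambda]] `&`
   ubound [set weight p | p in [set` Lambda]]) m.

Variable m : nat.

Definition Lambda_m : {fset nat * nat} :=
  [fset p in Lambda | weight p == m%:Z]%fset.

(* a_{j,r,j-m}(z); for (j,r) in Lambda_m one has m <= j. *)
Definition lead (p : nat * nat) : fps R := a p.1 p.2 (p.1 - m)%N.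

Definition alpha (p : nat * nat) : nat := ord (lead p).

(* \tilde a_{j,r,j-m}(z) = z^(-alpha) a_{j,r,j-m}(z) *)
Definition lead_unit (p : nat * nat) : fps R := fun k => lead p (alpha p + k)%N.

Definition Ptilde (n : nat) : nat -> fps R := fun r =>
  \sum_(p <- Lambda_m | p.2 == r) (n ^_ (p.1 - m))%:R *: lead p.

Definition zlevel (p : nat * nat) : int := (alpha p)%:Z - p.2%:Z.

Definition is_min_zlevel (l : int) : Prop :=
  ([set zlevel p | p in [set` Lambda_m]] `&`
   lbound [set zlevel p | p in [set` Lambda_m]]) l.

Variable l : int.

Definition Lambda_ml : {fset nat * nat} :=
  [fset p in Lambda_m | zlevel p == l]%fset.

(* As a power series in z, so that W_{m,l}(n,k,0) is [W n k 0%N]. *)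
Definition W (n k : nat) : fps R :=
  \sum_(p <- Lambda_ml) ((n ^_ (p.1 - m))%:R * (k ^_ p.2)%:R) *: lead_unit p.

Definition condA : Prop :=
  (forall n, is_lower_ordinate (Ptilde n) l) /\ l = 0.

Definition condB (s : R) : Prop :=
  forall n, (inv_order s <= first_positive_slope (newton_polygon (Ptilde n)))%E.

Definition condC : Prop := forall n k, W n k 0%N <> 0.

End PrincipalPart.

(* P \partial_t^{-m} is a linear automorphism on C[[t,z]] which extends to an
   automorphism on C[[z]]_s[[t]]. *)
Definition automorphism_extends (R : realType) (s : R)
    (Lambda : {fset nat * nat}) (a : nat -> nat -> fps2 R) (m : nat) : Prop :=
  let T := fun u : fps2 R => pdo Lambda a (iter m (@intt R) u) in
  linear_automorphism_on setT T /\ linear_automorphism_on (gevrey_t s) T.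

(* Main.v *)
Require Import Defs.
From mathcomp Require Import all_boot all_order all_algebra finmap complex.
From mathcomp Require Import all_classical all_reals all_analysis.
From mathcomp Require Import measurable_realfun lra ring zify.
Import Order.TTheory GRing.Theory Num.Theory.
Import numFieldNormedType.Exports.
Local Open Scope classical_set_scope.
Local Open Scope ring_scope.
Set Implicit Arguments.
Unset Strict Implicit.
Unset Printing Implicit Defensive.

(* The operator T = P \partial_t^{-m} is lower triangular with respect to the
   powers of t, with the operators L_n = \tilde P_m(n, \partial_z) on the diagonal,
   and (a) or (c) forces l >= 0, so that each L_n is lower triangular with respect
   to the powers of z: the coefficient of z^k in L_n w is
   \sum_(q <= k) c_(k-q)(q) w_q with polynomials c_i, and c_0(q) = W_{m,0}(n, q, 0).
   Hence T is bijective on C[[t,z]] as soon as c_0 has no zero on the integers;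
   conversely, going up in n, a bijective T has surjective L_n, and a surjective
   L_n has c_0(q) <> 0 for all q, which gives l = 0, (a) and (c).

   When l = 0, let p be the largest j with ord b_j = j in L_n = \sum_j b_j \partial_z^j.
   Condition (b) says that j <= p + s i whenever b_j has a monomial z^(i + j).
   If this holds, solving L_n w = f recursively gives |w_k| <= D A^k k!^s for A large.
   If it fails, let j - s i be maximal at (J, I), I minimal.  In the equation at
   z^(k + I) for L_n w = z^K, where k maximizes |w_k| / (A^k k!^s), the term
   c_I(k) w_k outweighs the others once A and then K are large: so
   the growth rate of L_n^{-1} z^K is unbounded in K, and a gliding hump
   yields a bounded f whose preimage is not Gevrey of order s. *)

(** * Moduli and asymptotic comparison *)

Section Modulus.
Variable R : realType.
Implicit Types x y : R[i].

(* The norm of R[i] takes its values in R[i]; [nrm] is the underlying real number. *)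
Definition nrm x : R := complex.Re `|x|.

Lemma normE x : `|x| = (nrm x)%:C%C.
Proof.
rewrite /nrm; have := normr_ge0 x; move: (`|x|) => [a b].
by rewrite lecE/= => /andP[/eqP-> _].
Qed.

Lemma nrm_ge0 x : 0 <= nrm x.
Proof. by rewrite -lecR -normE normr_ge0. Qed.

Lemma nrm0 : nrm 0 = 0.
Proof. by rewrite /nrm normr0. Qed.

Lemma nrm1 : nrm 1 = 1.
Proof. by rewrite /nrm normr1. Qed.

Lemma nrm_eq0 x : nrm x = 0 -> x = 0.
Proof. by move=> x0; apply/eqP; rewrite -normr_eq0 normE x0. Qed.

Lemma nrm_gt0 x : x <> 0 -> 0 < nrm x.
Proof. by move=> x0; rewrite lt_def nrm_ge0 andbT; apply/eqP => /nrm_eq0. Qed.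

Lemma nrmM x y : nrm (x * y) = nrm x * nrm y.
Proof. by apply: complexI; rewrite rmorphM/= -!normE normrM. Qed.

Lemma nrmN x : nrm (- x) = nrm x.
Proof. by rewrite /nrm normrN. Qed.

Lemma nrmD x y : nrm (x + y) <= nrm x + nrm y.
Proof. by rewrite -lecR rmorphD/= -!normE ler_normD. Qed.

Lemma nrmX x n : nrm (x ^+ n) = nrm x ^+ n.
Proof. by elim: n => [|n IH]; rewrite ?expr0 ?nrm1// !exprS nrmM IH. Qed.

Lemma nrm_nat n : nrm n%:R = n%:R.
Proof. by apply: complexI; rewrite -normE normr_nat rmorph_nat. Qed.

Lemma nrm_sum I (r : seq I) (P : pred I) (F : I -> R[i]) :
  nrm (\sum_(i <- r | P i) F i) <= \sum_(i <- r | P i) nrm (F i).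
Proof.
elim/big_rec2: _ => [|i y x _ h]; first by rewrite nrm0.
by apply: le_trans (nrmD _ _) _; rewrite lerD2l.
Qed.

End Modulus.

Lemma ffact_le_exp n j : (n ^_ j <= n ^ j)%N.
Proof.
elim: j n => [|j IH] n; first by rewrite ffactn0.
by rewrite ffactnSr expnSr leq_mul// leq_subr.
Qed.

Lemma leq_exp2r_w m n j : (m <= n)%N -> (m ^ j <= n ^ j)%N.
Proof. by case: j => // j mn; rewrite leq_exp2r. Qed.

(** As 2j + 1 <= n, each of the j factors n - i is at least half, hence a quarter, of n + 1. The
    induction runs over i <= j so that this bound stays available. *)
Lemma exp_le_ffact n j : (2 * j + 1 <= n)%N -> (n.+1 ^ j <= 4 ^ j * n ^_ j)%N.
Proof.
move=> jn; suff h i : (i <= j)%N -> (n.+1 ^ i <= 4 ^ i * n ^_ i)%N by exact: h.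
elim: i => [|i IH] ij //.
rewrite ffactnSr !expnSr mulnACA leq_mul ?IH 1?ltnW//; lia.
Qed.

Section LittleO.
Variable R : realType.
Implicit Types F G H : nat -> R.

(** The relation F = o(G) at infinity, one-sided: it serves for nonnegative F and G, so no modulus
    is taken. *)
Definition little F G :=
  forall e : R, 0 < e -> exists K, forall k, (K <= k)%N -> F k <= e * G k.

Lemma little_le F F' G (C : R) : 0 < C -> (forall k, F k <= C * F' k) ->
  little F' G -> little F G.
Proof.
move=> C0 h h' e e0; have Ce0 : 0 < C^-1 * e by rewrite mulr_gt0// invr_gt0.
have [K hK] := h' _ Ce0.
exists K => k /hK hk; apply: le_trans (h k) _.
by rewrite -ler_pdivlMl// mulrA.
Qed.

Lemma little_sum d (F : nat -> nat -> R) G : (forall k, 0 <= G k) ->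
  (forall j, (j < d)%N -> little (F j) G) ->
  little (fun k => \sum_(j < d) F j k) G.
Proof.
move=> G0; elim: d => [|d IH] h e e0.
  by exists 0%N => k _; rewrite big_ord0 mulr_ge0// ltW.
have e20 : 0 < e / 2 by rewrite divr_gt0.
have [K1 h1] := IH (fun j jd => h j (ltnW jd)) _ e20.
have [K2 h2] := h d (ltnSn d) _ e20.
exists (maxn K1 K2) => k; rewrite geq_max => /andP[k1 k2].
rewrite big_ord_recr/= (splitr e) mulrDl; apply: lerD; first exact: h1.
exact: h2.
Qed.

Lemma little_powR (e1 e2 : R) : e1 < e2 ->
  little (fun k => k.+1%:R `^ e1) (fun k => k.+1%:R `^ e2).
Proof.
move=> e12 e e0.
have d0 : 0 < e2 - e1 by rewrite subr_gt0.
(* After division by (k+1)^e1 the claim is (k+1)^(e2 - e1) >= 1/e, which holds from (1/e)^(1/(e2 -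
   e1)) on. *)
have [K hK] : exists K : nat, e^-1 `^ (e2 - e1)^-1 <= K%:R.
  by exists (Num.trunc (e^-1 `^ (e2 - e1)^-1)).+1; apply/ltW/truncnS_gt.
exists K => k Kk.
rewrite -(subrK e1 e2) powRD; last by apply/implyP.
rewrite mulrA ler_peMl ?powR_ge0// mulrC -ler_pdivrMr// mul1r.
apply: (@le_trans _ _ ((e^-1 `^ (e2 - e1)^-1) `^ (e2 - e1))).
  by rewrite -powRrM mulVf ?gt_eqF// powRr1// invr_ge0 ltW.
rewrite ge0_ler_powR ?nnegrE ?powR_ge0 ?ltW//.
by apply: le_lt_trans hK _; rewrite ltr_nat ltnS.
Qed.

Lemma little_expr (j j' : nat) : (j < j')%N ->
  little (fun k => k.+1%:R ^+ j : R) (fun k => k.+1%:R ^+ j' : R).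
Proof.
move=> jj' e e0.
have jj : j%:R < j'%:R :> R by rewrite ltr_nat.
have [K hK] := little_powR jj e0.
by exists K => k /hK; rewrite !powR_mulrn.
Qed.

(** The sum is a polynomial in k of exact degree J. Its leading term is at least |b_J| (k+1)^J / 4^J
    by [exp_le_ffact], and the terms of lower degree eventually take away at most half of that. *)
Lemma poly_lower_bound (b : nat -> R[i]) d J : (J < d)%N -> b J <> 0 ->
  (forall j, (j < d)%N -> b j <> 0 -> (j <= J)%N) ->
  exists2 c : R, 0 < c & exists K, forall k, (K <= k)%N ->
    c * k.+1%:R ^+ J <= nrm (\sum_(j < d) b j * (k ^_ j)%:R).
Proof.
move=> Jd bJ hb.
pose beta := nrm (b J); have beta0 : 0 < beta by exact: nrm_gt0.
pose G k : R := k.+1%:R ^+ J.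
have [K1 h1] : exists K, forall k, (K <= k)%N ->
    \sum_(j < d | j != Ordinal Jd) nrm (b j * (k ^_ j)%:R) <= beta / 2 / 4 ^+ J * G k.
  have := @little_sum d (fun j k => if j == J then 0 else nrm (b j * (k ^_ j)%:R)) G.
  move=> /(_ (fun k => exprn_ge0 _ (ler0n _ _))) h.
  have b0 : 0 < beta / 2 / 4 ^+ J by rewrite !divr_gt0// exprn_gt0.
  have {h} := h _ (beta / 2 / 4 ^+ J) b0.
  case=> [j jd e e0|K hK]; last first.
    exists K => k /hK; rewrite [in X in _ -> X]big_mkcond/=.
    by under [in X in _ -> X]eq_bigr do rewrite -val_eqE/= if_neg.
  have [jJ|jJ] := eqVneq j J.
    by exists 0%N => k _; rewrite mulr_ge0 ?exprn_ge0// ltW.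
  have [bj|/eqP bj] := eqVneq (b j) 0.
    by exists 0%N => k _; rewrite bj mul0r nrm0 mulr_ge0 ?exprn_ge0// ltW.
  have jJ' : (j < J)%N by rewrite ltn_neqAle jJ hb.
  apply: (little_le (nrm_gt0 bj) _ (little_expr jJ')) e e0 => k.
    rewrite nrmM nrm_nat ler_wpM2l ?nrm_ge0// -natrX ler_nat.
    exact: leq_trans (ffact_le_exp _ _) (leq_exp2r_w _ (leqnSn k)).
exists (beta / 2 / 4 ^+ J); first by rewrite !divr_gt0// exprn_gt0.
exists (maxn K1 (2 * J + 1)) => k; rewrite geq_max => /andP[k1 k2].
rewrite (bigD1 (Ordinal Jd))//=.
set S := \sum_(_ < _ | _) _.
have hS : nrm S <= beta / 2 / 4 ^+ J * G k := le_trans (nrm_sum _ _ _) (h1 _ k1).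
have hm : beta / 4 ^+ J * G k <= nrm (b J * (k ^_ J)%:R).
  rewrite nrmM nrm_nat -mulrA ler_wpM2l ?nrm_ge0// /G.
  rewrite mulrC ler_pdivrMr ?exprn_gt0// -!natrX -natrM ler_nat mulnC.
  exact: exp_le_ffact.
have : nrm (b J * (k ^_ J)%:R) <= nrm (b J * (k ^_ J)%:R + S) + nrm S.
  by rewrite -[X in nrm X <= _](addrK S); apply: le_trans (nrmD _ _) _; rewrite nrmN.
move: hS hm; rewrite /G.
set X := k.+1%:R ^+ J; set Y := 4 ^+ J.
rewrite (_ : beta / 2 / Y * X = (beta / Y * X)/2) ?(mulrAC _ 2^-1)//. lra.
Qed.
End LittleO.

(** * Gevrey series and factorials *)

Section Weight.
Variables (R : realType) (s : R).
Hypothesis s_ge0 : 0 <= s.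

(** Stands for Gamma(1 + s n) in all estimates; [Gamma_bounds] shows that the two differ by
    geometric factors only, so [gev s] below is [gevrey s]. *)
Definition wt n : R := n`!%:R `^ s.

Lemma wt_gt0 n : 0 < wt n.
Proof. by rewrite powR_gt0// ltr0n fact_gt0. Qed.

Lemma fact_addn_ge n i : (n`! * n.+1 ^ i <= (n + i)`!)%N.
Proof.
elim: i => [|i IH]; first by rewrite expn0 muln1 addn0.
rewrite addnS factS expnSr mulnA mulnC.
by apply: leq_mul => //; rewrite ltnS leq_addr.
Qed.

Lemma le_wt m n : (m <= n)%N -> wt m <= wt n.
Proof.
move=> mn; rewrite ge0_ler_powR ?nnegrE ?ler0n// ler_nat.
by rewrite -(subnKC mn); apply: leq_trans (fact_addn_ge _ _); rewrite leq_pmulr ?expn_gt0.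
Qed.

Lemma fact_addn_le n i : ((n + i)`! <= n`! * (n + i) ^ i)%N.
Proof.
elim: i => [|i IH]; first by rewrite expn0 muln1 addn0.
rewrite addnS factS expnS mulnCA leq_mul//.
apply: leq_trans IH _; rewrite leq_mul//; exact: leq_exp2r_w.
Qed.

(** This is how s enters the estimates: a shift by z^i is worth the power (n+1)^(s i), so that a
    factor (n+1)^j with j <= p + s i costs only (n+1)^p. *)
Lemma wt_addn_ge n i : wt n * n.+1%:R `^ (s * i%:R) <= wt (n + i).
Proof.
rewrite mulrC (mulrC s) powRrM powR_mulrn// -powRM ?exprn_ge0//.
rewrite ge0_ler_powR ?nnegrE ?mulr_ge0 ?exprn_ge0//.
by rewrite -natrX -natrM ler_nat mulnC fact_addn_ge.
Qed.

Lemma wt_addn_le n i : wt (n + i) <= wt n * (n + i)%:R `^ (s * i%:R).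
Proof.
rewrite mulrC (mulrC s) powRrM powR_mulrn// -powRM ?exprn_ge0//.
rewrite ge0_ler_powR ?nnegrE ?mulr_ge0 ?exprn_ge0//.
by rewrite -natrX -natrM ler_nat mulnC fact_addn_le.
Qed.

Definition gev : set (fps R) := [set u | exists B A : R, [/\ 0 < B, 0 < A &
  forall n, nrm (u n) <= B * A ^+ n * wt n]].

End Weight.

Section GammaBounds.
Variables (R : realType) (s : R).
Hypothesis s_ge0 : 0 <= s.
Notation mu := (@lebesgue_measure R).

Let f (n : nat) (y : R) : R := y `^ (1 + s * n%:R - 1) * expR (- y).

Let fE n y : f n y = y `^ (s * n%:R) * expR (- y).
Proof. by rewrite /f addrAC subrr add0r. Qed.

Let mf n (D : set R) : measurable_fun D (fun y => (f n y)%:E).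
Proof.
apply/measurable_EFinP/measurable_funTS; apply: measurable_funM.
  exact: measurable_powR.
apply: continuous_measurable_fun => x; apply: continuous_comp.
  exact: oppr_continuous.
exact: continuous_expR.
Qed.

Let f0 n y : (0 <= (f n y)%:E)%E.
Proof. by rewrite lee_fin mulr_ge0 ?powR_ge0 ?expR_ge0. Qed.

Let mexpN (D : set R) : measurable_fun D (fun y => (expR (- (y / 2)))%:E).
Proof.
apply/measurable_EFinP/measurable_funTS.
apply: continuous_measurable_fun => x; apply: (@continuous_comp _ _ _ (fun y : R => - (y / 2)) expR).
  by apply: continuousN; apply: continuousM => //; exact: cst_continuous.
exact: continuous_expR.
Qed.

(** The integrand is twice the exponential density of rate 1/2, whose total mass is 1. *)
Lemma integral_expR_half :
  (\int[mu]_(y in `]0%R, +oo[) (expR (- (y / 2)))%:E <= 2%:E)%E.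
Proof.
have r0 : 0 < 2^-1 :> R by rewrite invr_gt0.
have mexp (D : set R) : measurable_fun D (fun y => (exponential_pdf (2^-1 : R) y)%:E).
  by apply/measurable_EFinP/measurable_funTS; exact: measurable_exponential_pdf.
have pdf0 x : (0 <= (exponential_pdf (2^-1 : R) x)%:E)%E.
  by rewrite lee_fin exponential_pdf_ge0// ltW.
have h : (\int[mu]_(y in `]0%R, +oo[) (exponential_pdf 2^-1 y)%:E <= 1)%E.
  rewrite -(integral_exponential_pdf r0); apply: ge0_subset_integral => //.
  - exact: mexp.
apply: (@le_trans _ _ (\int[mu]_(y in `]0%R, +oo[) (2%:E * (exponential_pdf 2^-1 y)%:E))%E).
  apply: ge0_le_integral => //.
  - exact: mexpN.
  - by apply: measurable_funeM; exact: mexp.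
  move=> x /=; rewrite in_itv/= andbT => x0.
  rewrite exponential_pdfE ?(ltW x0)// -EFinM lee_fin mulrA divff// mul1r.
  by rewrite mulNr mulrC.
rewrite ge0_integralZl// ?lee_fin//; last exact: mexp.
by rewrite -[leRHS]mule1 lee_wpmul2l// lee_fin.
Qed.

(** Half of the exponential absorbs the power: with x = y/(2s), the inequality x^n / n! <= e^x
    raised to the power s bounds y^(s n) by (2s)^(s n) n!^s e^(y/2). The case s = 0 is apart because
    of the division by 2s. *)
Let f_le n y : 0 < y ->
  f n y <= (2 * s) `^ (s * n%:R) * wt s n * expR (- (y / 2)).
Proof.
move=> y0; rewrite fE.
have [->|s0] := eqVneq s 0.
  rewrite mul0r powRr0 powRr0 !mul1r /wt powRr0 mul1r ler_expR lerN2.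
  lra.
have {s0} s0 : 0 < s by rewrite lt_def s0.
have -> : expR (- y) = expR (- (y / 2)) * expR (- (y / 2)).
  by rewrite -expRD; congr expR; field.
rewrite mulrA ler_wpM2r ?expR_ge0// expRN ler_pdivrMr ?expR_gt0//.
have -> : expR (y / 2) = expR (y / (2 * s)) `^ s.
  by rewrite -expRM; congr expR; field; rewrite gt_eqF.
rewrite /wt !(mulrC s _%:R) !powRrM -!powRM ?mulr_ge0 ?powR_ge0 ?expR_ge0//.
rewrite ge0_ler_powR ?nnegrE ?mulr_ge0 ?powR_ge0 ?expR_ge0//.
rewrite !powR_mulrn ?mulr_ge0 ?(ltW y0)//.
have : (y / (2 * s)) ^+ n / n`!%:R <= expR (y / (2 * s)).
  case: n => [|n]; first by rewrite expr0 fact0 divr1 -[leLHS]expR0 ler_expR divr_ge0 ?mulr_ge0 ?ltW.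
  apply: le_trans (expR_ge1Dxn n _); last by rewrite divr_ge0 ?mulr_ge0 ?ltW.
  by rewrite lerDr.
rewrite ler_pdivrMr ?ltr0n ?fact_gt0// expr_div_n ler_pdivrMr ?exprn_gt0 ?mulr_gt0//.
by move=> /le_trans; apply; rewrite mulrC (mulrC (expR _)) mulrA.
Qed.

(** The upper bound integrates [f_le]. The lower bound keeps only the interval ]n, n+1], where y^(s
    n) >= (n^n)^s >= n!^s and e^(-y) >= e^(-1-n). *)
Lemma Gamma_bounds : exists a b : R, [/\ 0 < a, 0 < b & forall n,
  expR (-1) * a ^+ n * wt s n <= Gamma (1 + s * n%:R) <= 2 * b ^+ n * wt s n].
Proof.
exists (expR (-1)), ((2 * s) `^ s + 1); split; first exact: expR_gt0.
  by rewrite ltr_wpDl ?powR_ge0.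
move=> n; rewrite /Gamma /Rintegral.
set I := (\int[_]_(y in _) _)%E.
have hu : (I <= (2 * ((2 * s) `^ s + 1) ^+ n * wt s n)%:E)%E.
  apply: (@le_trans _ _ (\int[mu]_(y in `]0%R, +oo[) (((2 * s) `^ (s * n%:R) * wt s n)%:E * (expR (- (y / 2)))%:E))%E).
    apply: ge0_le_integral => //.
    - by move=> y _; exact: f0.
    - exact: (mf n).
    - by apply: measurable_funeM; exact: mexpN.
    - move=> y; rewrite /= in_itv/= andbT => y0; rewrite -EFinM lee_fin. exact: f_le.
  rewrite ge0_integralZl//; last 2 first.
  - exact: mexpN.
  - by rewrite lee_fin mulr_ge0 ?powR_ge0 ?(ltW (wt_gt0 _ _)).
  apply: (le_trans (lee_wpmul2l _ integral_expR_half)).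
    by rewrite lee_fin mulr_ge0 ?powR_ge0 ?(ltW (wt_gt0 _ _)).
  rewrite -EFinM lee_fin mulrC mulrA ler_wpM2r ?(ltW (wt_gt0 _ _))// ler_wpM2l//.
  rewrite powRrM powR_mulrn ?powR_ge0// lerXn2r ?nnegrE ?addr_ge0 ?powR_ge0//.
  by rewrite lerDl.
have hl : ((expR (-1) * expR (-1) ^+ n * wt s n)%:E <= I)%E.
  apply: (@le_trans _ _ (\int[mu]_(y in `]n%:R%R, (n%:R + 1)%R]) (cst (expR (-1) * expR (-1) ^+ n * wt s n)%:E y))%E).
    rewrite integral_cst//= lebesgue_measure_itv/= lte_fin ltrDl ltr01.
    by rewrite -EFinD addrAC subrr add0r mule1.
  apply: (@le_trans _ _ (\int[mu]_(y in `]n%:R%R, (n%:R + 1)%R]) (f n y)%:E)%E).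
    apply: ge0_le_integral => //.
    - by move=> y _; rewrite lee_fin !mulr_ge0 ?exprn_ge0 ?expR_ge0 ?(ltW (wt_gt0 _ _)).
    - exact: (mf n).
    - move=> y; rewrite /= in_itv/= => /andP[y0 y1]; rewrite lee_fin fE mulrC.
      rewrite -exprS -expRM_natl ler_pM ?expR_ge0 ?(ltW (wt_gt0 _ _))//.
        rewrite (mulrC s) powRrM ge0_ler_powR ?nnegrE ?powR_ge0 ?ler0n//.
        have yn : 0 <= y by apply: le_trans (ltW y0).
        rewrite powR_mulrn//; apply: (@le_trans _ _ (n%:R ^+ n)).
          by have := fact_addn_le 0 n; rewrite mul1n -natrX ler_nat.
        by rewrite lerXn2r ?nnegrE// ltW.
      by rewrite ler_expR mulrN1 lerN2 -natr1.
  apply: ge0_subset_integral => //.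
  - exact: (mf n).
  move=> y; rewrite /= !in_itv/= andbT => /andP[y0 _].
  exact: le_lt_trans y0.
(* [Gamma] is the real part [fine] of the extended integral, which is 0 at infinity; the bounds pass
   to it only once I is finite. *)
have If : I \is a fin_num.
  rewrite ge0_fin_numE; last by apply: integral_ge0 => y _; exact: f0.
  by apply: le_lt_trans hu _; rewrite ltry.
by rewrite -!lee_fin fineK// hu hl.
Qed.

Lemma gevreyE : gevrey s = gev s.
Proof.
have [a [b [a0 b0 h]]] := Gamma_bounds.
have G0 n : 0 <= Gamma (1 + s * n%:R).
  case/andP: (h n) => + _; apply: le_trans.
  by rewrite !mulr_ge0 ?exprn_ge0 ?expR_ge0 ?(ltW a0) ?(ltW (wt_gt0 _ _)).
apply/seteqP; split => u /= [B [A [B0 A0 hu]]].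
  exists (2 * B), (A * b); split; [by rewrite mulr_gt0|by rewrite mulr_gt0|] => n.
  have := hu n; rewrite normE lecR => /le_trans; apply.
  case/andP: (h n) => _ hn.
  rewrite exprMn (_ : 2 * B * _ * _ = B * A ^+ n * (2 * b ^+ n * wt s n)); last ring.
  by rewrite ler_wpM2l// mulr_ge0 ?exprn_ge0 ?ltW.
exists (B / expR (-1)), (A / a); split; [by rewrite divr_gt0 ?expR_gt0|by rewrite divr_gt0|] => n.
rewrite normE lecR; apply: le_trans (hu n) _.
case/andP: (h n) => hn _.
rewrite expr_div_n (_ : B / _ * _ * _ = B * A ^+ n / (expR (-1) * a ^+ n) * Gamma (1 + s * n%:R)).
  rewrite [leRHS]mulrAC ler_pdivlMr ?mulr_gt0 ?exprn_gt0 ?expR_gt0//.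
  by rewrite -[leLHS]mulrA ler_wpM2l ?mulr_ge0 ?exprn_ge0 ?(ltW A0) ?(ltW B0)// mulrC.
by rewrite invfM; ring.
Qed.

End GammaBounds.

(** * Triangular operators *)

Section Triangular.
Variables (V : zmodType) (T : (nat -> V) -> nat -> V) (D : nat -> V -> V).
Hypothesis triT : forall n u v, (forall i, (i < n)%N -> u i = v i) ->
  T u n - D n (u n) = T v n - D n (v n).

Definition seqs_in (G : set V) : set (nat -> V) := [set u | forall n, G (u n)].

(** Forward substitution, entry by entry. It is used at two levels: with V = C[[z]] for the powers
    of t, and with V = C for the powers of z. The set G carries the growth condition on the
    entries. *)
Lemma triangular_bij (G : set V) : G 0 -> (forall x y, G x -> G y -> G (x - y)) ->
  (forall u, seqs_in G u -> seqs_in G (T u)) ->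
  (forall n, set_bij G G (D n)) -> set_bij (seqs_in G) (seqs_in G) T.
Proof.
move=> G0 GB GT bijD; split; first exact: GT.
  move=> u v; rewrite !inE => Gu Gv Tuv; apply/funext => n.
  elim/ltn_ind: n => n IH.
  have := triT IH; rewrite Tuv => /addrI/oppr_inj Dn.
  by case: (bijD n) => _ inj _; apply: inj; rewrite ?inE.
move=> f Gf.
have [g hg] : exists g : nat -> V -> V,
    forall n y, G y -> G (g n y) /\ D n (g n y) = y.
  have /choice [g hg] : forall ny : nat * V, exists x, G ny.2 -> G x /\ D ny.1 x = ny.2.
    move=> [n y]; case: (bijD n) => _ _ surj.
    have [/surj[x Gx <-]|nGy] := pselect (G y); first by exists x.
    by exists 0.
  by exists (fun n y => g (n, y)) => n y /(hg (n, y)).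
(* [F N] holds the first N entries of the solution, followed by zeros. Entry n solves the diagonal
   equation whose right-hand side is f n minus the off-diagonal part, computed from [F n]. *)
pose fix F N : nat -> V := if N is n.+1 then
  fun i => if i == n then g n (f n - (T (F n) n - D n (F n n))) else F n i else fun=> 0.
have GF N : seqs_in G (F N).
  elim: N => [//|N IH] i /=; case: ifP => // _.
  by apply: (hg _ _ _).1; do 2![apply: (GB) => //]; [exact: GT|case: (bijD N) => + _ _; apply].
pose u n := F n.+1 n.
have uF N i : (i < N)%N -> u i = F N i.
  elim: N => // N IH; rewrite ltnS leq_eqVlt => /predU1P[->//|iN].
  by rewrite IH//= ltn_eqF.
exists u; first by move=> n; exact: GF.
apply/funext => n.
have := triT (uF n); rewrite {2}/u /= eqxx.
rewrite (hg _ _ _).2; last first.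
  by do 2![apply: (GB) => //]; [exact: GT|case: (bijD n) => + _ _; apply; exact: GF].
by move/eqP; rewrite subr_eq subrKC => /eqP.
Qed.

(** Lift the sequence with y at index n and 0 elsewhere: injectivity of the earlier diagonal maps
    kills the entries of the preimage below n, so its n-th entry is sent to y by [D n]. *)
Lemma triangular_diag_surj (G : set V) n : G 0 -> T 0 = 0 -> (forall i, D i 0 = 0) ->
  set_surj (seqs_in G) (seqs_in G) T -> (forall i, (i < n)%N -> injective (D i)) ->
  set_surj G G (D n).
Proof.
move=> G0 T0 D0 surjT injD y Gy.
have [i|u Gu Tu] := surjT (fun i => if i == n then y else 0).
  by rewrite /=; case: ifP.
exists (u n) => //.
have u0 i : (i < n)%N -> u i = (0 : nat -> V) i.
  elim/ltn_ind: i => i IH ni; apply: (injD i ni).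
  have := triT (fun j ji => IH j ji (ltn_trans ji ni)).
  by rewrite Tu T0 /= ltn_eqF// D0 subr0 sub0r => /eqP; rewrite oppr_eq0 => /eqP.
have := triT u0; rewrite Tu T0 eqxx D0 subr0 => /eqP.
by rewrite subr_eq0 => /eqP.
Qed.

End Triangular.

Section LowerOperator.
Variables (R : realType) (d : nat) (b : nat -> fps R).

(* the coefficient of z^(q + i) in the image of z^q under \sum_j b_j \partial_z^j,
   when every b_j is divisible by z^j *)
Definition coef i q : R[i] := \sum_(j < d) b j (i + j)%N * (q ^_ j)%:R.

Definition lower_op (w : fps R) : fps R :=
  fun k => \sum_(q < k.+1) coef (k - q) q * w q.

Definition zpow K : fps R := fun k => (k == K)%:R.

Lemma lower_op_recr w k :
  lower_op w k = \sum_(q < k) coef (k - q) q * w q + coef 0 k * w k.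
Proof. by rewrite /lower_op big_ord_recr/= subnn. Qed.

Lemma lower_op_tri k (u v : fps R) : (forall i, (i < k)%N -> u i = v i) ->
  lower_op u k - coef 0 k * u k = lower_op v k - coef 0 k * v k.
Proof.
move=> uv; rewrite !lower_op_recr !addrK.
by apply: eq_bigr => q _; rewrite uv.
Qed.

Lemma lower_op0 : lower_op 0 = 0.
Proof. by apply/funext => k; rewrite /lower_op big1// => q _; rewrite mulr0. Qed.

Lemma lower_opD u v : lower_op (u + v) = lower_op u + lower_op v.
Proof.
apply/funext => k; rewrite /lower_op !fctE -big_split/=.
by apply: eq_bigr => q _; rewrite mulrDr.
Qed.

Lemma lower_op_bij : (forall q, coef 0 q <> 0) -> set_bij setT setT lower_op.
Proof.
move=> c0.
rewrite (_ : setT = seqs_in [set: R[i]^o]); last by apply/seteqP; split.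
apply: (@triangular_bij _ _ (fun q x => coef 0 q * x)) => //.
  by move=> *; exact: lower_op_tri.
move=> q; have /eqP cq := c0 q; split => //.
  by move=> x y _ _ /(mulfI cq).
by move=> y _; exists ((coef 0 q)^-1 * y); rewrite // mulVKf.
Qed.

(** By induction the earlier diagonal coefficients are nonzero, so multiplication by the q-th one is
    surjective on C and it cannot be 0. *)
Lemma lower_op_surj_coef : set_surj setT setT lower_op -> forall q, coef 0 q <> 0.
Proof.
move=> surj q.
elim/ltn_ind: q => q IH c0.
have inj i : (i < q)%N -> injective (fun x : R[i]^o => coef 0 i * x).
  by move=> /IH/eqP; exact: mulfI.
have := @triangular_diag_surj _ _ (fun q x => coef 0 q * x) lower_op_tri setT q.
rewrite (_ : seqs_in _ = setT); last by apply/seteqP; split.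
case/(_ Logic.I lower_op0 (fun i => mulr0 _) surj inj 1 Logic.I) => x _ /eqP.
by rewrite c0 mul0r eq_sym oner_eq0.
Qed.

End LowerOperator.

(** * Inverses on Gevrey series *)

(** Only finitely many indices are exceptional, and each one is met by lowering c to the quotient F
    K / G K. *)
Lemma eventually_lower_bound (R : realType) (F G : nat -> R) (c : R) K :
  (forall k, 0 < F k) -> (forall k, 0 < G k) -> 0 < c ->
  (forall k, (K <= k)%N -> c * G k <= F k) ->
  exists2 c' : R, 0 < c' & forall k, c' * G k <= F k.
Proof.
move=> F0 G0; elim: K c => [|K IH] c c0 h; first by exists c => // k; exact: h.
apply: (IH (Num.min c (F K / G K))); first by rewrite lt_min c0 divr_gt0.
move=> k; rewrite leq_eqVlt => /predU1P[<-|Kk].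
  by rewrite -ler_pdivlMr// ge_min lexx orbT.
by apply: le_trans (h k Kk); rewrite ler_pM2r// ge_min lexx.
Qed.

(** The point is the factor B/(A - B): it becomes as small as needed when A grows, which tames the
    off-diagonal terms. *)
Lemma sum_geometric_le (R : realType) (A B : R) k : 0 < B -> B < A ->
  \sum_(q < k) B ^+ (k - q) * A ^+ q <= A ^+ k * (B / (A - B)).
Proof.
move=> B0 BA; have AB0 : 0 < A - B by rewrite subr_gt0.
elim: k => [|k IH].
  by rewrite big_ord0 expr0 mul1r divr_ge0// ltW.
rewrite big_ord_recr/= subSnn expr1.
under eq_bigr => q _ do rewrite subSn ?(ltnW (ltn_ord q))// exprS -mulrA.
rewrite -mulr_sumr -mulrDr.
apply: (@le_trans _ _ (B * (A ^+ k * (B / (A - B)) + A ^+ k))).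
  by rewrite ler_pM2l// lerD2r.
rewrite exprS le_eqVlt; apply/orP; left; apply/eqP; field.
by rewrite gt_eqF.
Qed.

Section GevreyInverse.
Variables (R : realType) (s : R).
Hypothesis s_ge0 : 0 <= s.
Variables (d : nat) (b : nat -> fps R) (C B : R).
Hypotheses (C_gt0 : 0 < C) (B_ge1 : 1 <= B).
Hypothesis bCB : forall j i, (j < d)%N -> nrm (b j i) <= C * B ^+ i.

Let B_gt0 : 0 < B. Proof. exact: lt_le_trans B_ge1. Qed.

Definition coef_cst : R := d%:R * C * B ^+ d.

Lemma coef_term_le i j q : (j < d)%N ->
  nrm (b j (i + j)%N * (q ^_ j)%:R) <= C * B ^+ d * B ^+ i * q.+1%:R ^+ j.
Proof.
move=> jd; rewrite nrmM nrm_nat ler_pM ?nrm_ge0//.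
  apply: le_trans (bCB _ jd) _; rewrite -mulrA ler_pM2l// -exprD addnC.
  by rewrite ler_weXn2l// leq_add2r ltnW.
rewrite -natrX ler_nat.
exact: leq_trans (ffact_le_exp _ _) (leq_exp2r_w _ (leqnSn q)).
Qed.

(** The exponent e bounds the orders j of the derivatives that raise the degree by i; the Newton
    polygon will supply it. The constant [coef_cst] collects d terms and B^(i+j) <= B^d B^i. *)
Lemma coef_le i q (e : R) :
  (forall j, (j < d)%N -> b j (i + j)%N <> 0 -> j%:R <= e) ->
  nrm (coef d b i q) <= coef_cst * B ^+ i * q.+1%:R `^ e.
Proof.
move=> he; apply: le_trans (nrm_sum _ _ _) _.
apply: (@le_trans _ _ (\sum_(j < d) C * B ^+ d * B ^+ i * q.+1%:R `^ e)); last first.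
  by rewrite sumr_const card_ord -[_ *+ d]mulr_natl /coef_cst !mulrA.
apply: ler_sum => j _.
have CB0 : 0 <= C * B ^+ d * B ^+ i by rewrite !mulr_ge0 ?exprn_ge0 ?ltW.
have [bj|/eqP bj] := eqVneq (b j (i + j)%N) 0.
  by rewrite bj mul0r nrm0 mulr_ge0 ?powR_ge0.
apply: le_trans (coef_term_le _ _ (ltn_ord j)) _.
rewrite ler_wpM2l// -powR_mulrn// ler_powR ?ler1n//; exact: he.
Qed.

Lemma lower_coef p : (p < d)%N -> b p p <> 0 ->
  (forall j, (j < d)%N -> b j j <> 0 -> (j <= p)%N) ->
  (forall q, coef d b 0 q <> 0) ->
  exists2 c : R, 0 < c & forall q, c * q.+1%:R ^+ p <= nrm (coef d b 0 q).
Proof.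
move=> pd bp hp c0.
have [c c_gt0 [K hK]] := @poly_lower_bound R (fun j => b j j) d p pd bp hp.
apply: (eventually_lower_bound _ _ c_gt0 hK) => k; first exact/nrm_gt0/c0.
by rewrite exprn_gt0.
Qed.

(** In the row c_0(k) w_k = f_k - (terms q < k), the weight absorbs (q+1)^(s(k-q)), so each term on
    the right carries at most the power (k+1)^p, the same as the lower bound on c_0(k). Strong
    induction then closes for a large rate A. *)
Lemma gev_lower_op_inv p w : (p < d)%N -> b p p <> 0 ->
  (forall j i, (j < d)%N -> b j (i + j)%N <> 0 -> j%:R <= p%:R + s * i%:R) ->
  (forall q, coef d b 0 q <> 0) ->
  gev s (lower_op d b w) -> gev s w.
Proof.
move=> pd bp hb c0 [F [a [F0 a0 hF]]].
have [c c_gt0 hc] : exists2 c : R, 0 < c & forall q, c * q.+1%:R ^+ p <= nrm (coef d b 0 q).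
  apply: lower_coef => // j jd bj.
  by have := hb j 0 jd bj; rewrite mulr0 addr0 ler_nat.
have d0 : (0 < d)%N by exact: leq_ltn_trans pd.
have C'0 : 0 < coef_cst by rewrite !mulr_gt0 ?exprn_gt0 ?ltr0n.
move: coef_cst C'0 coef_le => C' C'0 hcoef.
(* From A - B >= t the off-diagonal sum takes at most half of c; the choice D = 2F/c below leaves
   the other half to f_k. *)
pose t : R := 2 * C' * B / c.
have t0 : 0 < t by rewrite divr_gt0// !mulr_gt0.
pose A : R := a + B + t.
have B0 : 0 < B by [].
have BA : B < A by rewrite /A; lra.
have aA : a <= A by rewrite /A; lra.
have A0 : 0 < A by lra.
pose D : R := 2 * F / c.
have D0 : 0 < D by rewrite divr_gt0 ?mulr_gt0.
exists D, A; split => // k; elim/ltn_ind: k => k IH.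
have wk0 := wt_gt0 s k.
have k0 : 0 < k.+1%:R ^+ p :> R by rewrite exprn_gt0.
have hfk : nrm (lower_op d b w k) <= F * A ^+ k * wt s k.
  apply: le_trans (hF k) _.
  by rewrite ler_pM2r// ler_pM2l// lerXn2r ?nnegrE ?(ltW a0) ?(ltW A0).
have hS : nrm (\sum_(q < k) coef d b (k - q) q * w q) <=
    C' * D * (A ^+ k * (B / (A - B))) * (k.+1%:R ^+ p * wt s k).
  apply: (@le_trans _ _ (\sum_(q < k) C' * D * (B ^+ (k - q) * A ^+ q) * (k.+1%:R ^+ p * wt s k))); last first.
    rewrite -mulr_suml -mulr_sumr ler_pM2r ?(mulr_gt0 k0 wk0)// ler_pM2l ?(mulr_gt0 C'0 D0)//.
    exact: sum_geometric_le.
  apply: le_trans (nrm_sum _ _ _) _; apply: ler_sum => q _.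
  rewrite nrmM.
  apply: (@le_trans _ _ (C' * B ^+ (k - q) * q.+1%:R `^ (p%:R + s * (k - q)%:R) * (D * A ^+ q * wt s q))).
    rewrite ler_pM ?nrm_ge0// ?IH//; apply: hcoef => j jd bj; exact: hb.
  rewrite powRD; last by apply/implyP.
  rewrite powR_mulrn//.
  set X := _ `^ _; have X0 : 0 <= X by exact: powR_ge0.
  rewrite [leLHS](_ : _ = C' * D * (B ^+ (k - q) * A ^+ q) * (q.+1%:R ^+ p * (wt s q * X))); last by ring.
  rewrite ler_pM2l ?(mulr_gt0 (mulr_gt0 C'0 D0)) ?mulr_gt0 ?exprn_gt0//.
  rewrite ler_pM ?mulr_ge0 ?exprn_ge0 ?(ltW (wt_gt0 _ _))//.
    by rewrite lerXn2r ?nnegrE// ler_nat ltnS ltnW.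
  by apply: le_trans (wt_addn_ge _ _ _) _ => //; rewrite subnKC ?(ltnW (ltn_ord q)).
have hc' : c * k.+1%:R ^+ p * nrm (w k) <= nrm (lower_op d b w k) +
    nrm (\sum_(q < k) coef d b (k - q) q * w q).
  apply: (@le_trans _ _ (nrm (coef d b 0 k * w k))).
    by rewrite nrmM ler_wpM2r ?nrm_ge0.
  rewrite -[in nrm (_ * _)](addKr (\sum_(q < k) coef d b (k - q) q * w q) (_ * w k)).
  by rewrite -lower_op_recr addrC; apply: le_trans (nrmD _ _) _; rewrite nrmN.
have hr : C' * (B / (A - B)) <= c / 2.
  rewrite mulrA ler_pdivrMr ?subr_gt0// -ler_pdivrMl ?divr_gt0//.
  rewrite invf_div (_ : 2 / c * (C' * B) = t); last by rewrite /t; ring.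
  by rewrite /A; lra.
have kp1 : 1 <= k.+1%:R ^+ p :> R by rewrite exprn_ege1// ler1n.
rewrite -(ler_pM2l (mulr_gt0 c_gt0 k0)).
apply: le_trans hc' _; apply: le_trans (lerD hfk hS) _.
have -> : c * k.+1%:R ^+ p * (D * A ^+ k * wt s k) =
   k.+1%:R ^+ p * F * A ^+ k * wt s k + (c / 2) * D * A ^+ k * (k.+1%:R ^+ p * wt s k).
  by rewrite /D; field; rewrite gt_eqF.
apply: lerD.
  by rewrite !ler_pM2r ?exprn_gt0// ler_peMl// ltW.
rewrite ler_pM2r ?mulr_gt0//.
rewrite [leLHS](_ : _ = C' * (B / (A - B)) * D * A ^+ k); last by ring.
by rewrite !ler_pM2r ?exprn_gt0.
Qed.

End GevreyInverse.

Lemma ord_neq0 (V : nmodType) (u : nat -> V) n : u n <> 0 ->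
  u (ord u) <> 0 /\ (ord u <= n)%N.
Proof.
move=> un; rewrite /ord; case: pselect => [h|[]]; last by exists n; apply/asboolP.
by case: ex_minnP => k /asboolP uk mink; split => //; apply: mink; exact/asboolP.
Qed.

Lemma little_powR_expr (R : realType) (e : R) J : e < J%:R ->
  little (fun k => k.+1%:R `^ e) (fun k => k.+1%:R ^+ J).
Proof.
move=> /little_powR h x /h[K hK]; exists K => k /hK.
by rewrite powR_mulrn.
Qed.

(** Since v tends to 0, it is at most v K > 0 from some index on, so its maximum over an initial
    segment containing K is global. *)
Lemma geometric_max (R : realType) (v : nat -> R) (F r : R) K :
  (forall k, 0 <= v k <= F * r ^+ k) -> 0 <= r < 1 -> 0 < v K ->
  exists2 k, 0 < v k & forall q, v q <= v k.
Proof.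
move=> hv /andP[r0 r1] vK.
have [N hN] : exists N, forall k, (N <= k)%N -> v k <= v K.
  have : (fun k => F * r ^+ k) @ \oo --> F * 0.
    by apply: cvgMl_tmp; apply: cvg_expr; rewrite ger0_norm.
  rewrite mulr0 => /cvgrPdist_lt /(_ _ vK)[N _ hN]; exists N => k /hN /=.
  rewrite sub0r normrN => /ltW; apply: le_trans.
  by apply: le_trans (ler_norm _); case/andP: (hv k).
pose M := (maxn N K).+1.
have KM : (K < M)%N by rewrite ltnS leq_maxr.
have [k _ hk] := @arg_maxP _ R 'I_M (Ordinal KM) xpredT (fun i => v i) isT.
have vKk : v K <= v k := hk (Ordinal KM) isT.
exists k; first exact: lt_le_trans vKk.
move=> q; have [qM|Mq] := ltnP q M; first exact: (hk (Ordinal qM) isT).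
by apply: le_trans vKk; apply: hN; apply: leq_trans Mq; rewrite leqW// leq_maxl.
Qed.

(** * Growth of preimages of monomials when the slope condition fails *)

Section Necessity.
Variables (R : realType) (s : R).
Hypothesis s_ge0 : 0 <= s.
Variables (d : nat) (b : nat -> fps R) (C B : R).
Hypotheses (C_gt0 : 0 < C) (B_ge1 : 1 <= B).
Hypothesis bCB : forall j i, (j < d)%N -> nrm (b j i) <= C * B ^+ i.

(** The rate A, existential in [gev], is fixed here: the gliding hump defeats one rate at a time. *)
Definition wt_bounded (A : R) (w : fps R) :=
  exists F, forall n, nrm (w n) <= F * A ^+ n * wt s n.

Lemma wt_boundedB A u v : wt_bounded A u -> wt_bounded A v -> wt_bounded A (u - v).
Proof.
move=> [F hF] [G hG]; exists (F + G) => n; rewrite !fctE.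
by apply: le_trans (nrmD _ _) _; rewrite nrmN !mulrDl lerD.
Qed.

Lemma lower_op_eq0 w K : (forall q, coef d b 0 q <> 0) ->
  (forall q, (q < K)%N -> lower_op d b w q = 0) -> forall q, (q < K)%N -> w q = 0.
Proof.
move=> c0 hw; elim/ltn_ind => q IH qK.
have := hw q qK; rewrite lower_op_recr big1 => [|i _]; last first.
  by rewrite IH ?mulr0// (ltn_trans _ qK).
by rewrite add0r => /eqP; rewrite mulf_eq0 => /orP[/eqP/c0//|/eqP].
Qed.

Section DominantTerm.
Variables (J I : nat).
Hypotheses (Jd : (J < d)%N) (I_gt0 : (0 < I)%N) (bJI : b J (I + J)%N <> 0).
Hypothesis dominant : forall j i, (j < d)%N -> b j (i + j)%N <> 0 ->
  j%:R - s * i%:R <= J%:R - s * I%:R.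
Hypothesis dominant_lt : forall j i, (j < d)%N -> b j (i + j)%N <> 0 -> (i < I)%N ->
  j%:R - s * i%:R < J%:R - s * I%:R.

(** The summands are the contributions of w_(k+t+1) to the equation at z^(k+I), in units of A^k
    k!^s. They involve i = I - t - 1 < I, where strict dominance gives j + s(t+1) < J. *)
Lemma upper_part_little (A : R) : 0 < A ->
  little (fun k => \sum_(t < I) nrm (coef d b (I - t.+1) (k + t.+1)) *
                     (A ^+ t.+1 * (wt s (k + t.+1) / wt s k)))
         (fun k => k.+1%:R ^+ J).
Proof.
move=> A0; have G0 k : 0 <= k.+1%:R ^+ J :> R by rewrite exprn_ge0.
apply: (@little_sum _ I (fun t k => nrm (coef d b (I - t.+1) (k + t.+1)) *
                     (A ^+ t.+1 * (wt s (k + t.+1) / wt s k)))) => // t tI.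
have w0 k : 0 <= A ^+ t.+1 * (wt s (k + t.+1) / wt s k).
  by rewrite mulr_ge0 ?divr_ge0 ?exprn_ge0 ?(ltW (wt_gt0 _ _))// ltW.
apply: (@little_le _ _ (fun k => \sum_(j < d) nrm (b j (I - t.+1 + j)%N * ((k + t.+1) ^_ j)%:R) *
           (A ^+ t.+1 * (wt s (k + t.+1) / wt s k))) _ 1) => // [k|].
  by rewrite mul1r -mulr_suml ler_wpM2r// nrm_sum.
apply: (@little_sum _ d (fun j k => nrm (b j (I - t.+1 + j)%N * ((k + t.+1) ^_ j)%:R) *
           (A ^+ t.+1 * (wt s (k + t.+1) / wt s k)))) => // j jd.
have [bj|/eqP bj] := eqVneq (b j (I - t.+1 + j)%N) 0.
  by move=> e e0; exists 0%N => k _; rewrite bj mul0r nrm0 mul0r mulr_ge0// ltW.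
have e1J : j%:R + s * t.+1%:R < J%:R.
  have := dominant_lt jd bj (ltac:(lia)).
  rewrite natrB// mulrBr; lra.
(* The powers of I + 1 come from k + t + 1 <= (I + 1)(k + 1). *)
pose D : R := nrm (b j (I - t.+1 + j)%N) * I.+1%:R ^+ j * A ^+ t.+1 * I.+1%:R `^ (s * t.+1%:R).
have D0 : 0 < D.
  by rewrite !mulr_gt0 ?exprn_gt0 ?powR_gt0 ?ltr0n// nrm_gt0.
apply: (little_le D0 _ (little_powR_expr e1J)) => k.
have kt : (k + t.+1 <= I.+1 * k.+1)%N by nia.
rewrite powRD; last by apply/implyP.
rewrite powR_mulrn//.
have h1 : nrm (b j (I - t.+1 + j)%N * ((k + t.+1) ^_ j)%:R) <=
   nrm (b j (I - t.+1 + j)%N) * (I.+1%:R ^+ j * k.+1%:R ^+ j).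
  rewrite nrmM nrm_nat ler_wpM2l ?nrm_ge0// -exprMn -natrM -natrX ler_nat.
  exact: leq_trans (ffact_le_exp _ _) (leq_exp2r_w _ kt).
have h2 : wt s (k + t.+1) / wt s k <=
    I.+1%:R `^ (s * t.+1%:R) * k.+1%:R `^ (s * t.+1%:R).
  rewrite ler_pdivrMr ?wt_gt0// mulrC; apply: le_trans (wt_addn_le s_ge0 _ _) _.
  rewrite ler_wpM2l ?(ltW (wt_gt0 _ _))// -powRM// ge0_ler_powR ?nnegrE ?mulr_ge0//.
  by rewrite -natrM ler_nat.
rewrite [leRHS](_ : _ = nrm (b j (I - t.+1 + j)%N) * (I.+1%:R ^+ j * k.+1%:R ^+ j) *
   (A ^+ t.+1 * (I.+1%:R `^ (s * t.+1%:R) * k.+1%:R `^ (s * t.+1%:R)))); last first.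
  by rewrite /D; ring.
by rewrite ler_pM ?nrm_ge0// ler_wpM2l ?exprn_ge0// ltW.
Qed.

(* At an index k maximizing |w_k| / (A^k k!^s), the term coef I k * w_k of the
   equation at z^(k + I) outweighs the sum of all the others. *)
Lemma monomial_preimage_unbounded (A' : R) : 0 < A' ->
  (forall q, coef d b 0 q <> 0) ->
  exists K0, forall K, (K0 <= K)%N -> forall w, lower_op d b w = @zpow R K ->
    ~ wt_bounded A' w.
Proof.
move=> A'0 c0.
have B_gt0 : 0 < B by exact: lt_le_trans B_ge1.
have [c c_gt0 [K1 hK1]] : exists2 c : R, 0 < c & exists K, forall k, (K <= k)%N ->
    c * k.+1%:R ^+ J <= nrm (coef d b I k).
  apply: (@poly_lower_bound R (fun j => b j (I + j)%N) d J Jd bJI) => j jd bj.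
  by have := dominant jd bj; rewrite lerD2r ler_nat.
have C'0 : 0 < coef_cst d C B.
  by rewrite !mulr_gt0 ?exprn_gt0 ?ltr0n// (leq_ltn_trans _ Jd).
have hcoef := coef_le C_gt0 B_ge1 bCB.
move: (coef_cst d C B) C'0 hcoef => C' C'0 hcoef.
(* The inequality A - B >= t keeps the part [S1] of the row below a third of c X, and A > A' makes
   the normalized coefficients v decay geometrically, so that they attain a maximum. *)
pose t : R := 3 * (C' * B ^+ I) * B / c.
have CBI : 0 < C' * B ^+ I by rewrite mulr_gt0 ?exprn_gt0.
have t0 : 0 < t by rewrite divr_gt0// mulr_gt0// mulr_gt0.
pose A : R := A' + B + t.
have BA : B < A by rewrite /A; lra.
have A'A : A' < A by rewrite /A; lra.
have A0 : 0 < A by lra.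
have hr : C' * B ^+ I * (B / (A - B)) <= c / 3.
  rewrite mulrA ler_pdivrMr ?subr_gt0// -ler_pdivrMl ?divr_gt0//.
  rewrite invf_div (_ : 3 / c * (C' * B ^+ I * B) = t); last by rewrite /t; ring.
  by rewrite /A; lra.
have c30 : 0 < c / 3 by rewrite divr_gt0.
have [K2 hK2] := upper_part_little A0 c30.
(* As w vanishes below K, the maximizing index k is at least K, hence beyond both thresholds. *)
exists (maxn K1 K2) => K; rewrite geq_max => /andP[K1K K2K] w hw [F hF].
have wK0 q : (q < K)%N -> w q = 0.
  by apply: lower_op_eq0 => // i iK; rewrite hw /zpow ltn_eqF.
have wK : w K <> 0.
  move=> wK; have := congr1 (@^~ K) hw.
  rewrite /zpow eqxx lower_op_recr big1 => [|q _]; last by rewrite wK0 ?mulr0.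
  by rewrite wK mulr0 addr0 => /eqP; rewrite eq_sym oner_eq0.
have AW q : 0 < A ^+ q * wt s q by rewrite mulr_gt0 ?exprn_gt0 ?wt_gt0.
pose v q : R := nrm (w q) / (A ^+ q * wt s q).
have [k vk0 hmax] : exists2 k, 0 < v k & forall q, v q <= v k.
  apply: (@geometric_max _ _ F (A' / A) K).
  - move=> q; rewrite divr_ge0 ?nrm_ge0 ?(ltW (AW q))//= ler_pdivrMr//.
    rewrite expr_div_n [leRHS](_ : _ = F * A' ^+ q * wt s q)//.
    by field; rewrite gt_eqF// exprn_gt0.
  - by rewrite divr_ge0 ?(ltW A0) ?(ltW A'0)//= ltr_pdivrMr// mul1r.
  - by rewrite divr_gt0// nrm_gt0.
have Kk : (K <= k)%N.
  by rewrite leqNgt; apply/negP => kK; move: vk0; rewrite /v wK0// nrm0 mul0r ltxx.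
have hw_le q : nrm (w q) <= v k * (A ^+ q * wt s q) by rewrite -ler_pdivrMr//; exact: hmax.
have hwk : nrm (w k) = v k * (A ^+ k * wt s k) by rewrite /v divfK// gt_eqF.
have k0 : 0 < k.+1%:R ^+ J :> R by rewrite exprn_gt0.
have wk0 := wt_gt0 s k.
pose X : R := v k * (A ^+ k * wt s k) * k.+1%:R ^+ J.
have X0 : 0 < X by rewrite mulr_gt0// mulr_gt0.
have lhs : c * X <= nrm (coef d b I k * w k).
  rewrite nrmM hwk [c * X](_ : _ = c * k.+1%:R ^+ J * (v k * (A ^+ k * wt s k))); last first.
    by rewrite /X; ring.
  rewrite ler_pM2r ?(mulr_gt0 vk0 (AW k))//; apply: hK1; exact: leq_trans Kk.
pose S1 := \sum_(q < k) coef d b (k + I - q) q * w q.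
pose S2 := \sum_(t < I) coef d b (I - t.+1) (k + t.+1) * w (k + t.+1)%N.
(* The right-hand side z^K has no term at k + I > K; the row is split into q < k, q = k and q >
   k. *)
have row : coef d b I k * w k = - (S1 + S2).
  have : lower_op d b w (k + I)%N = 0.
    by rewrite hw /zpow gtn_eqF// (leq_ltn_trans Kk)// -[X in (X < _)%N]addn0 ltn_add2l.
  rewrite /lower_op -addnS big_split_ord/= big_ord_recl/= addn0 addKn.
  rewrite (_ : \sum_(i < I) _ = S2); last first.
    by apply: eq_bigr => i _; rewrite subnDl.
  by move=> /eqP; rewrite addrCA addr_eq0 => /eqP.
(* For q < k dominance at i = k + I - q reads j <= J + s(k - q), and the excess s(k - q) goes into
   the weight. *)
have hS1 : nrm S1 <= c / 3 * X.
  apply: (@le_trans _ _ (\sum_(q < k) C' * B ^+ I * v k * (B ^+ (k - q) * A ^+ q) * (k.+1%:R ^+ J * wt s k))); last first.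
    rewrite -mulr_suml -mulr_sumr.
    apply: (@le_trans _ _ (C' * B ^+ I * v k * (A ^+ k * (B / (A - B))) * (k.+1%:R ^+ J * wt s k))).
      rewrite ler_pM2r ?(mulr_gt0 k0 wk0)// ler_pM2l ?(mulr_gt0 CBI vk0)//.
      exact: sum_geometric_le.
    rewrite [leLHS](_ : _ = C' * B ^+ I * (B / (A - B)) * X); last by rewrite /X; ring.
    by rewrite ler_pM2r.
  apply: le_trans (nrm_sum _ _ _) _; apply: ler_sum => q _.
  have qk : (q <= k)%N by rewrite ltnW.
  rewrite nrmM.
  apply: (@le_trans _ _ (C' * B ^+ (k + I - q) * q.+1%:R `^ (J%:R + s * (k - q)%:R) * (v k * (A ^+ q * wt s q)))).
    rewrite ler_pM ?nrm_ge0//; apply: hcoef => j jd bj.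
    have := dominant jd bj; rewrite natrB ?(leq_trans qk (leq_addr _ _))// natrD natrB//.
    by rewrite !mulrBr mulrDr; lra.
  rewrite powRD; last by apply/implyP.
  rewrite powR_mulrn// addnC -addnBA// exprD.
  set Y := _ `^ _; have Y0 : 0 <= Y by exact: powR_ge0.
  rewrite [leLHS](_ : _ = C' * B ^+ I * v k * (B ^+ (k - q) * A ^+ q) * (q.+1%:R ^+ J * (wt s q * Y))); last by ring.
  rewrite ler_pM2l ?(mulr_gt0 (mulr_gt0 CBI vk0)) ?mulr_gt0 ?exprn_gt0//.
  rewrite ler_pM ?mulr_ge0 ?exprn_ge0 ?(ltW (wt_gt0 _ _))//.
    by rewrite lerXn2r ?nnegrE// ler_nat ltnS ltnW.
  by apply: le_trans (wt_addn_ge _ _ _) _ => //; rewrite subnKC.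
have hS2 : nrm S2 <= c / 3 * X.
  apply: le_trans (nrm_sum _ _ _) _.
  apply: (@le_trans _ _ (v k * (A ^+ k * wt s k) * \sum_(t < I) nrm (coef d b (I - t.+1) (k + t.+1)) *
                     (A ^+ t.+1 * (wt s (k + t.+1) / wt s k)))).
    rewrite mulr_sumr; apply: ler_sum => i _; rewrite nrmM.
    apply: (@le_trans _ _ (nrm (coef d b (I - i.+1) (k + i.+1)) * (v k * (A ^+ (k + i.+1) * wt s (k + i.+1))))).
      by rewrite ler_wpM2l ?nrm_ge0.
    rewrite exprD le_eqVlt; apply/orP; left; apply/eqP; field.
    by rewrite gt_eqF.
  rewrite [c / 3 * X](_ : _ = v k * (A ^+ k * wt s k) * (c / 3 * k.+1%:R ^+ J)); last first.
    by rewrite /X; ring.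
  rewrite ler_pM2l ?(mulr_gt0 vk0 (AW k))//; apply: hK2; exact: leq_trans Kk.
have : c * X <= c / 3 * X + c / 3 * X.
  apply: (le_trans lhs); rewrite row nrmN.
  by apply: le_trans (nrmD _ _) _; exact: lerD.
have cX0 : 0 < c * X by rewrite mulr_gt0.
rewrite -mulrDl (_ : c / 3 + c / 3 = 2 / 3 * c); last by field.
rewrite -mulrA; lra.
Qed.

End DominantTerm.
End Necessity.

(** * The gliding hump *)

Section GlidingHump.
Variables (R : realType) (s : R).
Hypothesis s_ge0 : 0 <= s.
Variables (d : nat) (b : nat -> fps R).
Hypothesis coef0_neq0 : forall q, coef d b 0 q <> 0.

Notation L := (lower_op d b).

(* The stages add z^K to the right-hand side, or not, so that the solution breaks
   the n-th bound at an index which the later stages leave untouched. *)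
Lemma gliding_hump :
  (forall N : nat, exists K0, forall K, (K0 <= K)%N -> forall w, L w = @zpow R K ->
     ~ wt_bounded s N%:R w) ->
  ~ set_surj (gev s) (gev s) L.
Proof.
move=> unb surjL; have [_ injL surjT] := lower_op_bij coef0_neq0.
(* A stage is a solution w with an index q. Under [P], its right-hand side is a polynomial of degree
   at most q with coefficients of modulus at most 1; [Q n] freezes the coefficients of w up to q and
   breaks the n-th bound before the next index. *)
pose P (x : fps R * nat) := (forall k, (x.2 < k)%N -> L x.1 k = 0) /\
   forall k, nrm (L x.1 k) <= 1.
pose Q (n : nat) (x y : fps R * nat) := [/\ P y, (x.2 < y.2)%N,
  (forall k, (k <= x.2)%N -> y.1 k = x.1 k) &
  exists2 k, (k <= y.2)%N & n%:R * n%:R ^+ k * wt s k < nrm (y.1 k)].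
have step n x : P x -> exists y, Q n x y.
  case: x => w q [/= Pw0 Pw1].
  have [K0 hK0] := unb n.
  pose K := maxn K0 q.+1.
  have qK : (q < K)%N by rewrite leq_max ltnSn orbT.
  have [U _ LU] := surjT (@zpow R K) Logic.I.
  have U0 k : (k < K)%N -> U k = 0.
    by apply: lower_op_eq0 => // i iK; rewrite LU /zpow ltn_eqF.
  (* If w already exceeds the rate n it is kept; otherwise w + U exceeds it, because U does. The
     choice K > q leaves the first coefficients of w unchanged. *)
  have [w' [ww' Lw' Lw'0 nw']] : exists w', [/\ (forall k, (k <= q)%N -> w' k = w k),
      forall k, nrm (L w' k) <= 1, (forall k, (K < k)%N -> L w' k = 0) &
      ~ wt_bounded s n%:R w'].
    have [bw|nbw] := pselect (wt_bounded s n%:R w); last first.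
      by exists w; split => // k Kk; apply: Pw0; exact: ltn_trans Kk.
    exists (w + U); split.
    - by move=> k kq; rewrite !fctE U0 ?addr0// (leq_ltn_trans kq).
    - move=> k; rewrite lower_opD LU !fctE /zpow.
      have [->|_] := eqVneq k K; last by rewrite addr0.
      by rewrite Pw0// add0r nrm1.
    - by move=> k Kk; rewrite lower_opD LU !fctE /zpow gtn_eqF// addr0 Pw0// (ltn_trans qK).
    - move=> bwU; apply: (hK0 K (leq_maxl _ _) U LU).
      by rewrite -(addKr w U) addrC; exact: wt_boundedB.
  have [k hk] : exists k, n%:R * n%:R ^+ k * wt s k < nrm (w' k).
    apply: contrapT => /forallNP h; apply: nw'; exists n%:R => k.
    by rewrite leNgt; apply/negP/h.
  exists (w', maxn K k); split => //=.
  - split => //= i; rewrite gtn_max => /andP[Ki _]; exact: Lw'0.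
  - by rewrite leq_max qK.
  - by exists k => //; rewrite leq_maxr.
have /choice[g hg] : forall nx : nat * (fps R * nat), exists y,
    P nx.2 -> Q nx.1 nx.2 y.
  move=> [n x]; have [/(step n)[y]|nP] := pselect (P x); first by exists y.
  by exists x.
pose fix st n := if n is n'.+1 then g (n', st n') else (0 : fps R, 0%N).
have Pst n : P (st n).
  elim: n => [|n IH]; last by case: (hg (n, st n) IH).
  by split => [k _|k] /=; rewrite lower_op0 ?nrm0.
have Qst n : Q n (st n) (st n.+1) by exact: (hg (n, st n) (Pst n)).
have qn n : (n <= (st n).2)%N.
  by elim: n => // n IH; case: (Qst n) => _ lt _ _; exact: leq_ltn_trans IH lt.
have stE n i k : (k <= (st n).2)%N -> (k <= (st (n + i)%N).2)%N /\ (st (n + i)%N).1 k = (st n).1 k.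
  move=> kn; elim: i => [|i [IHq IHw]]; first by rewrite addn0; split.
  rewrite addnS; case: (Qst (n + i)%N) => _ lt eqw _; split; last by rewrite eqw.
  exact: leq_trans IHq (ltnW lt).
(* The limit can be read on the diagonal: stage k has frozen its coefficients at least up to index
   k. *)
pose u : fps R := fun k => (st k).1 k.
have uE n k : (k <= (st n).2)%N -> u k = (st n).1 k.
  move=> kn; rewrite /u; have [nk|kn'] := leqP n k.
    by rewrite -(subnKC nk); case: (stE n (k - n)%N k kn); rewrite subnKC.
  by have [_] := stE k (n - k)%N k (qn k); rewrite subnKC ?(ltnW kn').
have LuE k : L u k = L (st k).1 k.
  apply: eq_bigr => i _; congr (_ * _); apply: uE.
  by apply: leq_trans (qn k); rewrite -ltnS.
have Lu_gev : gev s (L u).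
  exists 1, 1; split => // k; rewrite LuE expr1n !mul1r.
  case: (Pst k) => _ /(_ k) /le_trans; apply.
  by apply: le_trans (le_wt s_ge0 (leq0n k)); rewrite /wt fact0 powR1.
have [v [F [A [F0 A0 hv]]] Lv] := surjL _ Lu_gev.
have vu : v = u by apply: injL; rewrite ?inE.
(* With n >= F + A, the Gevrey bound of the preimage contradicts the n-th bound broken at stage n +
   1. *)
pose n := (Num.trunc (F + A)).+1.
have FAn : F + A <= n%:R by apply/ltW/truncnS_gt.
have [_ _ _ [k kq]] := Qst n; rewrite -uE// -vu ltNge => /negP; apply.
apply: le_trans (hv k) _; rewrite ler_wpM2r ?(ltW (wt_gt0 _ _))//.
rewrite ler_pM ?exprn_ge0 ?(ltW A0) ?(ltW F0)//; first lra.
by rewrite lerXn2r ?nnegrE ?(ltW A0)//; lra.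
Qed.

End GlidingHump.

(** * The slope condition from surjectivity on Gevrey series *)

Section SlopeNecessity.
Variables (R : realType) (s : R).
Hypothesis s_ge0 : 0 <= s.
Variables (d : nat) (b : nat -> fps R) (C B : R).
Hypotheses (C_gt0 : 0 < C) (B_ge1 : 1 <= B).
Hypothesis bCB : forall j i, (j < d)%N -> nrm (b j i) <= C * B ^+ i.

Lemma gev_surj_slope p : (forall q, coef d b 0 q <> 0) ->
  (forall j, (j < d)%N -> b j j <> 0 -> (j <= p)%N) ->
  set_surj (gev s) (gev s) (lower_op d b) ->
  forall j i, (j < d)%N -> b j (i + j)%N <> 0 -> j%:R <= p%:R + s * i%:R.
Proof.
move=> c0 hp surj j0 i0 j0d bj0; rewrite leNgt; apply/negP => viol.
pose h j := ord (fun i => b j (i + j)%N).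
have hP j i : b j (i + j)%N <> 0 -> b j (h j + j)%N <> 0 /\ (h j <= i)%N.
  exact: (@ord_neq0 _ (fun i => b j (i + j)%N)).
pose val (j : nat) : R := j%:R - s * (h j)%:R.
(* [S] discards the j for which [h j] is the junk order of the zero series. *)
pose S (j : 'I_d) := `[< b j (h j + j)%N <> 0 >].
have S0 : S (Ordinal j0d) by apply/asboolP; case: (hP _ _ bj0).
have [jm Sm hm] := @arg_maxP _ R _ _ S (fun j => val j) S0.
(* On a line where j - s i is constant, a smaller j never comes with a larger i, so the least
   maximizer J also has the least [h J]; this yields strict dominance below [h J]. *)
have exJ : exists j, `[< (j < d)%N /\ b j (h j + j)%N <> 0 /\ val j = val jm >].
  by exists jm; apply/asboolP; split => //; split => //; exact/asboolP.
case: (ex_minnP exJ) => J /asboolP[Jd [bJ valJ]] minJ.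
have val_le j i : (j < d)%N -> b j (i + j)%N <> 0 -> j%:R - s * i%:R <= val j /\ val j <= val J.
  move=> jd bj; have [bhj hji] := hP _ _ bj; split.
    by rewrite lerB// ler_wpM2l// ler_nat.
  by rewrite valJ; apply: (hm (Ordinal jd)); exact/asboolP.
have dom j i : (j < d)%N -> b j (i + j)%N <> 0 -> j%:R - s * i%:R <= J%:R - s * (h J)%:R.
  by move=> jd bj; have [h1 h2] := val_le j i jd bj; exact: le_trans h2.
have dom_lt j i : (j < d)%N -> b j (i + j)%N <> 0 -> (i < h J)%N ->
    j%:R - s * i%:R < J%:R - s * (h J)%:R.
  move=> jd bj ij; rewrite lt_neqAle dom// andbT; apply/negP => /eqP eqJ.
  have [h1 h2] := val_le j i jd bj; have [bhj hji] := hP _ _ bj.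
  have vj : val j = val J by apply/eqP; rewrite eq_le h2/=; rewrite /val -eqJ.
  have Jj : (J <= j)%N by apply: minJ; apply/asboolP; rewrite vj.
  have jJ : (j <= J)%N.
    rewrite -(ler_nat R); have : s * i%:R <= s * (h J)%:R by rewrite ler_wpM2l// ler_nat ltnW.
    by move: eqJ; lra.
  have jJE : j = J by apply/eqP; rewrite eqn_leq jJ.
  by move: ij; rewrite ltnNge -jJE hji.
(* If [h J] were 0, then J <= p, and dominance over (j0, i0) would contradict [viol]. *)
have hJ0 : (0 < h J)%N.
  rewrite lt0n; apply/eqP => hJ0.
  have := dom _ _ j0d bj0; have := bJ; rewrite hJ0 add0n mulr0 subr0 => /(hp J Jd).
  rewrite -(ler_nat R); lra.
apply: (gliding_hump s_ge0 c0 _ surj) => N.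
(* The rate N + 1 is used because a positive rate is required; [|F|] below copes with the unknown
   sign of F. *)
have [K0 hK0] := monomial_preimage_unbounded s_ge0 C_gt0 B_ge1 bCB Jd hJ0 bJ dom dom_lt
  (ltr0Sn R N) c0.
exists K0 => K KK0 w Lw [F hF]; apply: (hK0 K KK0 w Lw).
exists `|F| => n; apply: le_trans (hF n) _.
rewrite ler_wpM2r ?(ltW (wt_gt0 _ _))//.
apply: (@le_trans _ _ (`|F| * N%:R ^+ n)); first by rewrite ler_wpM2r ?exprn_ge0// ler_norm.
by rewrite ler_wpM2l// lerXn2r ?nnegrE// ler_nat.
Qed.

End SlopeNecessity.

(** * The first positive slope *)

Section NewtonPolygon.
Variables (R : realType) (b : nat -> fps R).

Lemma halfplane_convex (c x0 y0 : R) :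
  convex_set ([set v | c <= x0 * v.1 + y0 * v.2] : set (R^o * R^o)%type).
Proof.
move=> v w t; rewrite !inE /= => hv hw.
have t0 : 0 <= t%:num by [].
have t1 : 0 <= 1 - t%:num by rewrite subr_ge0.
have -> : c = t%:num * c + (1 - t%:num) * c by ring.
have : t%:num * c + (1 - t%:num) * c <= t%:num * (x0 * v.1 + y0 * v.2) +
    (1 - t%:num) * (x0 * w.1 + y0 * w.2).
  by rewrite lerD// ler_wpM2l.
move=> /le_trans; apply; rewrite le_eqVlt; apply/orP; left; apply/eqP.
rewrite [RHS](_ : _ = x0 * (t%:num * v.1 + (1 - t%:num) * w.1) +
  y0 * (t%:num * v.2 + (1 - t%:num) * w.2)) //.
ring.
Qed.

(** With these signs of the normal, a half-plane containing the corner of a quadrant contains the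
    quadrant; convexity does the rest. *)
Lemma newton_polygon_halfplane (c x0 y0 : R) : x0 <= 0 -> 0 <= y0 ->
  (forall j, op_supp b j -> c <= x0 * j%:R + y0 * (op_height b j)%:~R) ->
  forall v, newton_polygon b v -> c <= x0 * v.1 + y0 * v.2.
Proof.
move=> hx hy h; suff : newton_polygon b `<=` [set v | c <= x0 * v.1 + y0 * v.2] by [].
apply: smallest_sub; first exact: halfplane_convex.
move=> v [j /= jb [v1 v2]]; apply: le_trans (h j jb) _.
by apply: lerD; [exact: ler_wnM2l|exact: ler_wpM2l].
Qed.

Lemma newton_polygon_quadrant j x y : op_supp b j -> x <= j%:R ->
  (op_height b j)%:~R <= y -> newton_polygon b (x, y).
Proof. by move=> jb hx hy; apply: sub_gen_smallest; exists j. Qed.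

(** The point (p, 0) is the right end of the bottom edge. For s > 0 the right-hand side says that
    every corner lies on or to the left of the line of slope 1/s through it. *)
Lemma first_positive_slopeP (s : R) p d : 0 <= s ->
  is_lower_ordinate b 0 -> (forall j, op_supp b j -> (j < d)%N) ->
  op_supp b p -> op_height b p = 0 ->
  (forall j, op_supp b j -> op_height b j = 0 -> (j <= p)%N) ->
  (inv_order s <= first_positive_slope (newton_polygon b))%E <->
  (forall j, op_supp b j -> j%:R <= p%:R + s * (op_height b j)%:~R).
Proof.
move=> s0 [_ lb] hd bp hp maxp.
have h0 j : op_supp b j -> 0 <= (op_height b j)%:~R :> R.
  by move=> jb; rewrite ler0z; apply: lb; exists j.
pose N := newton_polygon b; split; last first.
  move=> hs; apply/ereal_infP => _ [sigma [+ /= sigma0] <-].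
  (* The polygon is unbounded upwards above (p, 0), so it cannot lie below the line through P and
     Q. *)
  move=> [P [Q [NP NQ PQ QE [above|below]]]]; last first.
    pose y : R := P.2 + sigma * (p%:R - P.1).
    have /below /= : N (p%:R, `|y| + 1).
      by apply: newton_polygon_quadrant bp (lexx _) _; rewrite hp addr_ge0.
    by rewrite -/y => ny; exfalso; have := ler_norm y; lra.
  suff hsg : 1 <= s * sigma.
    rewrite /inv_order; have [sE|sN] := eqVneq s 0.
      by move: hsg; rewrite sE mul0r ler10.
    have sgt0 : 0 < s by rewrite lt_def sN.
    by rewrite lee_fin -(ler_pM2l sgt0) divff.
  (* Since (p, 0) is above the line PQ, Q.2 <= sigma (Q.1 - p), while Q.1 - p <= s Q.2. If s sigma <
     1 this forces Q.1 = p and Q.2 = 0, so P would lie below height 0. *)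
  rewrite leNgt; apply/negP => hsg.
  have y0 v : N v -> 0 <= v.2.
    move=> Nv; have := @newton_polygon_halfplane 0 0 1 (lexx _) ler01 _ v Nv.
    by rewrite mul0r mul1r add0r; apply => j jb; rewrite mul0r mul1r add0r h0.
  have sy v : N v -> v.1 - p%:R <= s * v.2.
    move=> Nv; have := @newton_polygon_halfplane (- p%:R) (-1) s _ s0 _ v Nv.
    have -> : (-1 : R) <= 0 by rewrite lerN10.
    move=> /(_ isT) h; have := h _; rewrite mulN1r => /(_ _) h'.
    have : - p%:R <= - v.1 + s * v.2.
      by apply: h' => j jb; rewrite mulN1r; have := hs j jb; lra.
    lra.
  have /above /= hp0 : N (p%:R, 0).
    by apply: newton_polygon_quadrant bp (lexx _) _; rewrite hp.
  have NQ2 := y0 _ NQ; have NQs := sy _ NQ; have NP2 := y0 _ NP.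
  have Q2 : Q.2 <= sigma * (Q.1 - p%:R) by move: QE hp0; lra.
  have Q1 : Q.1 - p%:R <= 0.
    have : Q.1 - p%:R <= s * sigma * (Q.1 - p%:R).
      by apply: le_trans NQs _; rewrite -mulrA ler_wpM2l.
    by rewrite leNgt => h; rewrite leNgt; apply: contra h => h; rewrite -subr_gt0; nra.
  have Q1' : Q.1 - p%:R = 0.
    have : 0 <= sigma * (Q.1 - p%:R) by exact: le_trans Q2.
    by rewrite pmulr_rge0// => h; apply/eqP; rewrite eq_le Q1.
  have : sigma * (Q.1 - P.1) <= 0.
    by move: Q2; rewrite Q1' mulr0 QE; lra.
  by rewrite pmulr_rle0//; lra.
move=> hs j0 bj0; rewrite leNgt; apply/negP => viol.
have gt0 j : op_supp b j -> (p < j)%N -> 0 < (op_height b j)%:~R :> R.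
  move=> jb pj; rewrite lt_def h0// andbT intr_eq0; apply/negP => /eqP.
  by move=> /(maxp j jb); rewrite leqNgt pj.
have pj0 : (p < j0)%N.
  by rewrite -(ltr_nat R); apply: le_lt_trans viol; rewrite lerDl mulr_ge0 ?h0.
pose S (j : 'I_d) := `[< op_supp b j >] && (p < j)%N.
have S0 : S (Ordinal (hd _ bj0)) by rewrite /S pj0 andbT; exact/asboolP.
(* The slope of the segment from (p, 0) to the corner of index j > p. The least of these slopes is
   that of an edge, hence at least 1/s, against the violation at j0. *)
pose slope (j : nat) : R := (op_height b j)%:~R / (j%:R - p%:R).
have [j1 /andP[/asboolP bj1 pj1] hmin] := @arg_minP _ R _ _ S (fun j => slope j) S0.
have sub_gt0 j : (p < j)%N -> 0 < j%:R - p%:R :> R by rewrite subr_gt0 ltr_nat.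
have sigma0 : 0 < slope j1 by rewrite divr_gt0 ?gt0 ?sub_gt0.
have lines j : op_supp b j -> slope j1 * (j%:R - p%:R) <= (op_height b j)%:~R.
  move=> jb; have [jp|pj] := leqP j p.
    by apply: le_trans (h0 j jb); rewrite pmulr_rle0// subr_le0 ler_nat.
  rewrite -ler_pdivlMr ?sub_gt0//; apply: (hmin (Ordinal (hd _ jb))).
  by rewrite /S pj andbT; exact/asboolP.
have edge : edge_slope N (slope j1).
  exists (p%:R, 0), (j1%:R, (op_height b j1)%:~R); split => /=.
  - by apply: newton_polygon_quadrant bp _ _; rewrite ?hp.
  - exact: newton_polygon_quadrant bj1 _ _.
  - by rewrite ltr_nat.
  - by rewrite add0r /slope divfK// gt_eqF// sub_gt0.
  - left => v Nv.
    have := @newton_polygon_halfplane (- slope j1 * p%:R) (- slope j1) 1 _ ler01 _ v Nv.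
    rewrite oppr_le0 ltW// => /(_ isT) h.
    suff : - slope j1 * p%:R <= - slope j1 * v.1 + 1 * v.2 by lra.
    by apply: h => j jb; have := lines j jb; lra.
have : (first_positive_slope N <= (slope j1)%:E)%E.
  by apply: ereal_inf_lbound; exists (slope j1).
move=> /(le_trans hs); rewrite /inv_order.
have [sE|sN] := eqVneq s 0; first by rewrite leye_eq.
have sgt0 : 0 < s by rewrite lt_def sN.
rewrite lee_fin => hs1.
have : slope j1 <= slope j0 by apply: (hmin (Ordinal (hd _ bj0))).
move=> /(le_trans hs1); rewrite /slope ler_pdivlMr ?sub_gt0// ler_pdivrMl//.
by move: viol; lra.
Qed.

End NewtonPolygon.

(** * Convergent coefficients *)

Section GevreyStability.
Variables (R : realType) (s : R).
Hypothesis s_ge0 : 0 <= s.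

(** Positive radius of convergence; 1 <= B lets exponents of B be enlarged. *)
Definition convergent (u : fps R) := exists C B : R, [/\ 0 < C, 1 <= B &
  forall i, nrm (u i) <= C * B ^+ i].

Lemma gev0 : gev s 0.
Proof.
exists 1, 1; split => // n; rewrite nrm0 expr1n !mul1r ltW ?wt_gt0//.
Qed.

Lemma gevD u v : gev s u -> gev s v -> gev s (u + v).
Proof.
move=> [B [A [B0 A0 hu]]] [B' [A' [B'0 A'0 hv]]].
exists (B + B'), (A + A'); split; [exact: addr_gt0|exact: addr_gt0|] => n.
apply: le_trans (nrmD _ _) _; rewrite !mulrDl; apply: lerD.
  apply: le_trans (hu n) _; rewrite ler_pM2r ?wt_gt0// ler_pM2l//.
  by rewrite lerXn2r ?nnegrE ?ltW ?addr_gt0// ltrDl.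
apply: le_trans (hv n) _; rewrite ler_pM2r ?wt_gt0// ler_pM2l//.
by rewrite lerXn2r ?nnegrE ?ltW ?addr_gt0// ltrDr.
Qed.

Lemma gevZ (c : R[i]) u : gev s u -> gev s (c *: u).
Proof.
move=> [B [A [B0 A0 hu]]]; exists ((nrm c + 1) * B), A; split => // [|n].
  by rewrite mulr_gt0// ltr_wpDl ?nrm_ge0.
rewrite nrmM -!mulrA ler_pM ?nrm_ge0 ?lerDl// mulrA; exact: hu.
Qed.

Lemma gevB u v : gev s u -> gev s v -> gev s (u - v).
Proof. by move=> gu gv; rewrite -scaleN1r; apply: gevD => //; exact: gevZ. Qed.

Lemma gev_sum I (r : seq I) (P : pred I) (F : I -> fps R) :
  (forall i, P i -> gev s (F i)) -> gev s (\sum_(i <- r | P i) F i).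
Proof. by move=> h; elim/big_ind: _ => //; [exact: gev0|exact: gevD]. Qed.

(** Differentiation costs the factor (k+1)^(1+s), at most (2^(1+s))^k, which goes into the rate. *)
Lemma gev_deriv u : gev s u -> gev s (fun k => k.+1%:R * u k.+1).
Proof.
move=> [B [A [B0 A0 hu]]].
exists (B * A), (A * 2 `^ (1 + s)); split => [||k]; [exact: mulr_gt0|by rewrite mulr_gt0 ?powR_gt0|].
rewrite nrmM nrm_nat.
apply: (@le_trans _ _ (k.+1%:R * (B * A ^+ k.+1 * (wt s k * k.+1%:R `^ s)))).
  rewrite ler_wpM2l//; apply: le_trans (hu k.+1) _.
  rewrite ler_pM2l ?mulr_gt0 ?exprn_gt0//.
  by have := wt_addn_le s_ge0 k 1; rewrite addn1 mulr1.
have -> : k.+1%:R * (B * A ^+ k.+1 * (wt s k * k.+1%:R `^ s)) =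
    B * A * A ^+ k * wt s k * (k.+1%:R `^ (1 + s)).
  rewrite powRD; last by apply/implyP.
  by rewrite powRr1// exprS; ring.
rewrite exprMn.
have -> : B * A * (A ^+ k * (2 `^ (1 + s)) ^+ k) * wt s k =
   B * A * A ^+ k * wt s k * (2 `^ (1 + s)) ^+ k by ring.
rewrite ler_pM2l ?mulr_gt0 ?exprn_gt0 ?wt_gt0//.
rewrite -powR_mulrn ?powR_ge0// -powRrM mulrC powRrM powR_mulrn//.
by rewrite ge0_ler_powR ?nnegrE ?addr_ge0 ?exprn_ge0// -natrX ler_nat ltn_expl.
Qed.

(** Each of the k + 1 products obeys the bound with rate A + B, and k + 1 <= 2^k. *)
Lemma gev_mul (a u : fps R) : convergent a -> gev s u ->
  gev s (fun k => \sum_(j < k.+1) a j * u (k - j)%N).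
Proof.
move=> [C [B [C0 B1 ha]]] [F [A [F0 A0 hu]]].
have B0 : 0 < B by exact: lt_le_trans B1.
exists (C * F), (2 * (A + B)); split => [||k]; [exact: mulr_gt0|by rewrite mulr_gt0 ?addr_gt0|].
have AB0 : 0 < A + B by exact: addr_gt0.
have W0 := wt_gt0 s k.
apply: le_trans (nrm_sum _ _ _) _.
apply: (@le_trans _ _ (\sum_(j < k.+1) C * F * (A + B) ^+ k * wt s k)).
  apply: ler_sum => j _; rewrite nrmM.
  have jk : (j <= k)%N by rewrite -ltnS.
  apply: (@le_trans _ _ (C * (A + B) ^+ j * (F * (A + B) ^+ (k - j) * wt s k))).
    rewrite ler_pM ?nrm_ge0//.
      apply: le_trans (ha j) _; rewrite ler_pM2l//.
      by rewrite lerXn2r ?nnegrE ?ltW// ltrDr.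
    apply: le_trans (hu _) _.
    apply: ler_pM; rewrite ?mulr_ge0 ?exprn_ge0 ?(ltW (wt_gt0 _ _)) ?(ltW F0) ?(ltW A0)//.
      by rewrite ler_pM2l// lerXn2r ?nnegrE ?(ltW A0) ?(ltW AB0)// lerDl ltW.
    by rewrite le_wt// leq_subr.
  rewrite [(A + B) ^+ k](_ : _ = (A + B) ^+ j * (A + B) ^+ (k - j)); last first.
    by rewrite -exprD subnKC.
  rewrite le_eqVlt; apply/orP; left; apply/eqP; ring.
rewrite sumr_const card_ord -[_ *+ k.+1]mulr_natl exprMn.
rewrite [leRHS](_ : _ = 2 ^+ k * (C * F * (A + B) ^+ k * wt s k)); last first.
  by move: (2 ^+ k) ((A + B) ^+ k) => x y; ring.
rewrite ler_wpM2r ?mulr_ge0 ?exprn_ge0 ?(ltW C0) ?(ltW F0) ?(ltW W0) ?(ltW AB0)//.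
by rewrite -natrX ler_nat ltn_expl.
Qed.

Lemma gevrey_tE : gevrey_t s = seqs_in (gev s).
Proof. by rewrite -gevreyE. Qed.

Lemma seqs_gev_dt u : seqs_in (gev s) u -> seqs_in (gev s) (dt u).
Proof. by move=> gu n; exact: gevZ. Qed.

Lemma seqs_gev_dz u : seqs_in (gev s) u -> seqs_in (gev s) (dz u).
Proof. by move=> gu n; exact: gev_deriv. Qed.

Lemma seqs_gev_intt u : seqs_in (gev s) u -> seqs_in (gev s) (intt u).
Proof. by move=> gu [|n]; [exact: gev0|exact: gevZ]. Qed.

Lemma seqs_gev_iter f m u : (forall v, seqs_in (gev s) v -> seqs_in (gev s) (f v)) ->
  seqs_in (gev s) u -> seqs_in (gev s) (iter m f u).
Proof. by move=> hf gu; elim: m => //= m IH; exact: hf. Qed.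

Lemma seqs_gev_mul a u : (forall i, convergent (a i)) ->
  seqs_in (gev s) u -> seqs_in (gev s) (mul_fps a u).
Proof.
move=> ca gu n; rewrite /mul_fps.
have -> : (fun k => \sum_(i < n.+1) \sum_(j < k.+1) a i j * u (n - i)%N (k - j)%N) =
   \sum_(i < n.+1) (fun k => \sum_(j < k.+1) a i j * u (n - i)%N (k - j)%N) :> fps R.
  by apply/funext => k; rewrite fct_sumE.
by apply: gev_sum => i _; exact: gev_mul.
Qed.

Lemma seqs_gev_pdo (Lambda : {fset nat * nat}) (a : nat -> nat -> fps2 R) u :
  (forall p i, p \in Lambda -> convergent (a p.1 p.2 i)) ->
  seqs_in (gev s) u -> seqs_in (gev s) (pdo Lambda a u).
Proof.
move=> ca gu n; rewrite /pdo big_seq fct_sumE; apply: gev_sum => p pL.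
apply: seqs_gev_mul => [i|]; first exact: ca.
apply: seqs_gev_iter; first exact: seqs_gev_dt.
by apply: seqs_gev_iter => //; exact: seqs_gev_dz.
Qed.

(** At a point z <> 0 of convergence the terms tend to 0, so |a_k| < |z|^(-k) for large k; the
    constant C covers the finitely many other k. *)
Lemma holo_fps_convergent (a : fps2 R) i : holo_fps a -> convergent (a i).
Proof.
move=> [U _ [f /(_ i)[_ hf]]].
have [e /= e0 he] := (@nbhs_ballP _ _ _ _).1 hf.
pose z : R[i]^o := e / 2.
have z0 : z != 0 by rewrite mulf_neq0 ?gt_eqF// invr_gt0.
have zball : ball (0 : R[i]^o) e z.
  rewrite -ball_normE /= sub0r normrN ger0_norm ?divr_ge0 ?(ltW e0)//.
  by rewrite /z gtr_pMr// invf_lt1 ?ltr1n.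
have /cvgP/cvg_series_cvg_0 /cvgrPdist_lt /(_ 1 ltr01)[N _ hN] := he z zball.
have nz0 : 0 < nrm z by apply/nrm_gt0/eqP.
pose B : R := 1 + (nrm z)^-1.
have zB : (nrm z)^-1 <= B by rewrite lerDr.
have B1 : 1 <= B by rewrite lerDl invr_ge0 ltW.
have B0 : 0 < B by exact: lt_le_trans B1.
pose C : R := 1 + \sum_(k < N) nrm (a i k).
have S0 : 0 <= \sum_(k < N) nrm (a i k) by apply: sumr_ge0 => k _; exact: nrm_ge0.
have C0 : 0 < C by rewrite /C; lra.
exists C, B; split => // k; have [Nk|kN] := leqP N k; last first.
  apply: (@le_trans _ _ C); last by rewrite ler_peMr ?(ltW C0)// exprn_ege1.
  rewrite /C (bigD1 (Ordinal kN))//=.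
  have : 0 <= \sum_(j < N | j != Ordinal kN) nrm (a i j) by apply: sumr_ge0 => j _; exact: nrm_ge0.
  lra.
have := hN k Nk; rewrite /= sub0r normrN normE -[1]/((1 : R)%:C%C) ltcR nrmM nrmX => h.
apply: (@le_trans _ _ (1 * B ^+ k)); last by rewrite ler_wpM2r ?exprn_ge0 ?(ltW B0)// lerDl.
rewrite mul1r; apply: (@le_trans _ _ ((nrm z)^-1 ^+ k)); last first.
  by rewrite lerXn2r ?nnegrE ?invr_ge0 ?(ltW nz0) ?(ltW B0).
by rewrite exprVn -[leRHS]mul1r ler_pdivlMr ?exprn_gt0// ltW.
Qed.

Lemma convergent0 : convergent 0.
Proof. by exists 1, 1; split => // i; rewrite nrm0 expr1n mul1r. Qed.

Lemma convergentD u v : convergent u -> convergent v -> convergent (u + v).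
Proof.
move=> [C [B [C0 B1 hu]]] [C' [B' [C'0 B'1 hv]]].
have B0 : 0 <= B by exact: le_trans B1.
have B'0 : 0 <= B' by exact: le_trans B'1.
exists (C + C'), (B * B'); split => [||i]; [exact: addr_gt0|exact: mulr_ege1|].
apply: le_trans (nrmD _ _) _; rewrite mulrDl; apply: lerD.
  apply: le_trans (hu i) _; rewrite ler_pM2l// lerXn2r ?nnegrE ?mulr_ge0//.
  by rewrite ler_peMr.
apply: le_trans (hv i) _; rewrite ler_pM2l// lerXn2r ?nnegrE ?mulr_ge0//.
by rewrite ler_peMl.
Qed.

Lemma convergentZ (c : R[i]) u : convergent u -> convergent (c *: u).
Proof.
move=> [C [B [C0 B1 hu]]]; exists ((nrm c + 1) * C), B; split => // [|i].
  by rewrite mulr_gt0// ltr_wpDl ?nrm_ge0.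
by rewrite nrmM -!mulrA ler_pM ?nrm_ge0 ?lerDl.
Qed.

Lemma convergent_uniform d (b : nat -> fps R) :
  (forall j, (j < d)%N -> convergent (b j)) -> exists C B : R, [/\ 0 < C, 1 <= B &
  forall j i, (j < d)%N -> nrm (b j i) <= C * B ^+ i].
Proof.
elim: d => [|d IH] h; first by exists 1, 1.
have [C [B [C0 B1 hu]]] := IH (fun j jd => h j (ltnW jd)).
have [C' [B' [C'0 B'1 hv]]] := h d (ltnSn d).
have B0 : 0 <= B by exact: le_trans B1.
have B'0 : 0 <= B' by exact: le_trans B'1.
exists (C + C'), (B * B'); split => [||j i]; [exact: addr_gt0|exact: mulr_ege1|].
rewrite exprMn ltnS leq_eqVlt => /predU1P[->|jd].
  apply: le_trans (hv i) _; rewrite ler_pM ?exprn_ge0 ?(ltW C'0)//.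
    by rewrite lerDr ltW.
  by rewrite ler_peMl ?exprn_ge0// exprn_ege1.
apply: le_trans (hu j i jd) _; rewrite ler_pM ?exprn_ge0 ?(ltW C0)//.
  by rewrite lerDl ltW.
by rewrite ler_peMr ?exprn_ge0// exprn_ege1.
Qed.

End GevreyStability.

(** * The diagonal of the operator *)

Section Structure.
Variables (R : realType).

Lemma iter_intt m (u : fps2 R) n : iter m (@intt R) u n =
  if (m <= n)%N then (n ^_ m)%:R^-1 *: u (n - m)%N else 0.
Proof.
elim: m n => [|m IH] n; first by rewrite leq0n ffactn0 invr1 scale1r subn0.
rewrite iterS /intt; case: n => [//|n]; rewrite IH ltnS subSS.
by case: ifP => _; rewrite ?scaler0// scalerA ffactSS natrM invfM.
Qed.

Lemma iter_dt j (v : fps2 R) n : iter j (@dt R) v n = ((n + j) ^_ j)%:R *: v (n + j)%N.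
Proof.
elim: j n => [|j IH] n; first by rewrite ffactn0 scale1r addn0.
rewrite iterS /dt IH scalerA -natrM addSnnS; congr (_%:R *: _).
by rewrite ffactnSr mulnC addnS -addSn addnK.
Qed.

Lemma iter_dz r (v : fps2 R) n k : iter r (@dz R) v n k = ((k + r) ^_ r)%:R * v n (k + r)%N.
Proof.
elim: r k => [|r IH] k; first by rewrite ffactn0 mul1r addn0.
rewrite iterS /dz IH mulrA -natrM addSnnS; congr (_%:R * _).
by rewrite ffactnSr mulnC addnS -addSn addnK.
Qed.

Lemma ffact_addn n m e : (n ^_ (m + e) = n ^_ m * (n - m) ^_ e)%N.
Proof.
elim: e => [|e IH]; first by rewrite addn0 ffactn0 muln1.
by rewrite addnS !ffactnSr IH subnDA mulnA.
Qed.

Lemma linear_dt : linear (@dt R).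
Proof.
move=> c u v; apply/funext => n; rewrite /dt.
rewrite -[LHS]/(n.+1%:R *: (c *: u n.+1 + v n.+1)).
by rewrite scalerDr scalerA mulrC -scalerA.
Qed.

Lemma linear_dz : linear (@dz R).
Proof.
move=> c u v; apply/funext => n; apply/funext => k.
rewrite -[LHS]/(k.+1%:R * (c * u n k.+1 + v n k.+1)).
by rewrite mulrDr mulrCA.
Qed.

Lemma linear_intt : linear (@intt R).
Proof.
move=> c u v; apply/funext => -[|n].
  by rewrite -[RHS]/(c *: 0 + 0) scaler0 addr0.
rewrite -[LHS]/(n.+1%:R^-1 *: (c *: u n + v n)).
by rewrite scalerDr scalerA mulrC -scalerA.
Qed.

Lemma linear_mul_fps a : linear (@mul_fps R a).
Proof.
move=> c u v; apply/funext => n; apply/funext => k.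
rewrite -[RHS]/(c * mul_fps a u n k + mul_fps a v n k) /mul_fps.
rewrite mulr_sumr -big_split/=; apply: eq_bigr => i _.
rewrite mulr_sumr -big_split/=; apply: eq_bigr => j _.
rewrite -[(_ + v) _ _]/(c * u (n - i)%N (k - j)%N + v (n - i)%N (k - j)%N).
by rewrite mulrDr mulrCA.
Qed.

Lemma linear_iter (f : fps2 R -> fps2 R) j : linear f -> linear (iter j f).
Proof. by move=> lf c u v; elim: j => //= j ->; exact: lf. Qed.

Variables (Lambda : {fset nat * nat}) (a : nat -> nat -> fps2 R) (m : nat).

Definition pdo_int (u : fps2 R) : fps2 R := pdo Lambda a (iter m (@intt R) u).

Lemma linear_pdo_int : linear pdo_int.
Proof.
move=> c u v; rewrite /pdo_int (linear_iter _ linear_intt) /pdo.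
rewrite scaler_sumr -big_split/=; apply: eq_bigr => p _.
by rewrite (linear_iter _ linear_dz) (linear_iter _ linear_dt) linear_mul_fps.
Qed.

Hypothesis a_neq0 : forall j r, (j, r) \in Lambda -> a j r <> 0.
Hypothesis m_max : is_max_weight Lambda a m%:Z.

Lemma weight_le (p : nat * nat) : p \in Lambda -> (p.1 <= m + ord (a p.1 p.2))%N.
Proof.
move=> pL; case: m_max => _ /(_ (weight a p)) /(_ (ex_intro2 _ _ p pL erefl)).
by rewrite /weight lerBlDr -PoszD lez_nat.
Qed.

Lemma weight_eq (p : nat * nat) : (weight a p == m%:Z) = (p.1 == m + ord (a p.1 p.2))%N.
Proof. by rewrite /weight subr_eq -PoszD eqz_nat. Qed.

Lemma coef_below_ord (p : nat * nat) i : p \in Lambda -> (m + i < p.1)%N -> a p.1 p.2 i = 0.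
Proof.
move=> pL mi; apply: contrapT => /ord_neq0[_ ordi].
by have := weight_le pL; lia.
Qed.

Lemma mem_Lambda_m (p : nat * nat) : p \in Lambda_m Lambda a m ->
  [/\ p \in Lambda, (m <= p.1)%N & lead a m p <> 0].
Proof.
rewrite /Lambda_m !inE weight_eq => /andP[pL /eqP wp]; split => //; first by rewrite wp leq_addr.
have ap : a p.1 p.2 <> 0 by apply: a_neq0; rewrite -surjective_pairing.
have [n an] : exists n, a p.1 p.2 n <> 0.
  apply: contrapT => /forallNP h; apply: ap; apply/funext => n.
  exact: contrapT (h n).
have [h _] := ord_neq0 an; rewrite /lead (_ : (p.1 - m)%N = ord (a p.1 p.2))//.
by rewrite {1}wp addKn.
Qed.

Lemma lead_eq0 (p : nat * nat) : p \in Lambda -> (m <= p.1)%N -> p \notin Lambda_m Lambda a m ->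
  lead a m p = 0.
Proof.
move=> pL mp; rewrite /Lambda_m !inE weight_eq pL/= => /eqP wp.
apply: contrapT => /(@ord_neq0 _ (a p.1 p.2))[_ ordi]; apply: wp.
by apply/eqP; rewrite eqn_leq weight_le//=; lia.
Qed.

(* the action of \tilde P_m(n, \partial_z) on C[[z]] *)
Definition diag_op n (x : fps R) : fps R := fun k =>
  \sum_(p <- Lambda_m Lambda a m) (n ^_ (p.1 - m))%:R *
    \sum_(j < k.+1) lead a m p j * (((k - j + p.2) ^_ p.2)%:R * x (k - j + p.2)%N).

Lemma diag_opD n x y : diag_op n (x + y) = diag_op n x + diag_op n y.
Proof.
apply/funext => k; rewrite /diag_op !fctE -big_split/=; apply: eq_bigr => p _.
rewrite -mulrDr -big_split/=; congr (_ * _); apply: eq_bigr => j _.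
by rewrite !mulrDr.
Qed.

(** If w starts at t^n, a term of weight less than m produces only powers above t^n; a term of
    weight m reaches t^n through its leading coefficient alone, at index p.1 - m. *)
Lemma pdo_int_first_coef n w : (forall i, (i < n)%N -> w i = 0) ->
  pdo_int w n = diag_op n (w n).
Proof.
move=> w0; apply/funext => k.
rewrite /pdo_int /pdo fct_sumE /diag_op fct_sumE.
rewrite /Lambda_m [RHS]big_fset/= [RHS]big_mkcond/=.
rewrite [LHS]big_seq [RHS]big_seq; apply: eq_bigr => -[p1 p2] pL; set p := (p1, p2).
rewrite /mul_fps.
pose X i j : R[i] := iter p.1 (@dt R) (iter p.2 (@dz R) (iter m (@intt R) w)) i j.
have XE i j : X i j = ((i + p.1) ^_ p.1)%:R * (((j + p.2) ^_ p.2)%:R *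
    (if (m <= i + p.1)%N then ((i + p.1) ^_ m)%:R^-1 *: w (i + p.1 - m)%N else 0) (j + p.2)%N).
  by rewrite /X iter_dt {1}/GRing.scale/= iter_dz iter_intt.
have X0 i j : (i + p.1 < n + m)%N -> X i j = 0.
  move=> ipn; rewrite XE; case: ifP => [mi|_]; last by rewrite !mulr0.
  rewrite w0 ?scaler0 ?mulr0//; lia.
have [pm|mp] := ltnP p.1 m.
  rewrite weight_eq ltn_eqF; last by rewrite (leq_trans pm)// leq_addr.
  rewrite big1 // => i _; rewrite big1 // => j _.
  by rewrite -/(X _ _) X0 ?mulr0//; lia.
pose e := (p.1 - m)%N.
have pe : p.1 = (m + e)%N by rewrite subnKC.
(* For i < e the coefficient of t^i in a is below its order, by maximality of m; for i > e the other
   factor is below the t-order of the differentiated series. *)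
have small (i : 'I_n.+1) : i != e :> nat ->
    \sum_(j < k.+1) a p.1 p.2 i j * X (n - i)%N (k - j)%N = 0.
  rewrite neq_ltn => /orP[ie|ei]; rewrite big1// => j _.
    by rewrite coef_below_ord ?mul0r// pe ltn_add2l.
  by rewrite X0 ?mulr0//; have := ltn_ord i; lia.
rewrite -/e; have [ne|en] := ltnP n e.
  rewrite big1 => [|i _]; last by apply: small; have := ltn_ord i; lia.
  by case: ifP => // _; rewrite ffact_small// mul0r.
have en1 : (e < n.+1)%N by [].
rewrite (bigD1 (Ordinal en1))//= [X in _ + X]big1 => [|i ie]; last first.
  exact: small.
rewrite addr0; case: ifP => [_|wpm]; last first.
  have /(congr1 (fun f : fps R => f)) : lead a m p = 0.
    by apply: lead_eq0 => //; rewrite /Lambda_m !inE pL/= wpm.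
  by rewrite /lead => ->; rewrite big1// => j _; rewrite mul0r.
rewrite mulr_sumr; apply: eq_bigr => j _.
rewrite -/(X _ _) XE [in RHS]mulrCA; congr (_ * _).
have -> : (n - e + p.1)%N = (n + m)%N by rewrite pe; lia.
(* Integration and differentiation combine into (n+m)^_(m+e) / (n+m)^_m = n^_e, the factor in \tilde
   P_m. *)
rewrite leq_addl addnK {1}/GRing.scale/= (pe : p1 = _) ffact_addn addnK natrM.
rewrite -[_ *: _]/(_ * _).
have nm0 : ((n + m) ^_ m)%:R != 0 :> R[i] by rewrite pnatr_eq0 -lt0n ffact_gt0 leq_addl.
by field.
Qed.

(** By linearity the first-coefficient formula applies to u - v, which vanishes below n. *)
Lemma pdo_int_tri n (u v : fps2 R) : (forall i, (i < n)%N -> u i = v i) ->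
  pdo_int u n - diag_op n (u n) = pdo_int v n - diag_op n (v n).
Proof.
move=> uv.
have h : pdo_int (u - v) n = diag_op n (u n - v n).
  by apply: pdo_int_first_coef => i /uv uvi;
    rewrite -[(u - v) i]/(u i - v i) uvi subrr.
have uE : pdo_int u n = diag_op n (u n - v n) + pdo_int v n.
  by rewrite -h -[in LHS](subrK v u) -[u - v in LHS]scale1r linear_pdo_int scale1r.
have dE : diag_op n (u n) = diag_op n (u n - v n) + diag_op n (v n).
  by rewrite -diag_opD subrK.
by rewrite uE dE opprD addrACA subrr add0r.
Qed.

Variable d : nat.
Hypothesis d_gt : forall p, p \in Lambda_m Lambda a m -> (p.2 < d)%N.
Hypothesis lead_low : forall p i, p \in Lambda_m Lambda a m -> (i < p.2)%N -> lead a m p i = 0.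

Lemma coef_Ptilde n i q : coef d (Ptilde Lambda a m n) i q =
  \sum_(p <- Lambda_m Lambda a m) (n ^_ (p.1 - m))%:R * lead a m p (i + p.2)%N * (q ^_ p.2)%:R.
Proof.
rewrite /coef /Ptilde.
under eq_bigr => j _ do rewrite fct_sumE mulr_suml big_mkcond/=.
rewrite exchange_big/= big_seq [RHS]big_seq; apply: eq_bigr => p pL.
rewrite (bigD1 (Ordinal (d_gt pL)))//= eqxx big1 ?addr0// => j.
by rewrite -val_eqE/= eq_sym => /negbTE ->.
Qed.

(** Substitute q = k - j + r. The ranges differ only by null terms: f_j = 0 for j < r, and the
    falling factorial q^_r is 0 for q < r. *)
Lemma reindex_derivation (f x : nat -> R[i]) r k : (forall i, (i < r)%N -> f i = 0) ->
  \sum_(j < k.+1) f j * (((k - j + r) ^_ r)%:R * x (k - j + r)%N) =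
  \sum_(q < k.+1) f (k - q + r)%N * (q ^_ r)%:R * x q.
Proof.
move=> f0; rewrite [RHS](reindex_inj rev_ord_inj)/=.
under [RHS]eq_bigr => i _ do rewrite subSS subKn -1?ltnS//.
pose F j : R[i] := f j * (((k - j + r) ^_ r)%:R * x (k - j + r)%N).
pose G j : R[i] := f (j + r)%N * ((k - j) ^_ r)%:R * x (k - j)%N.
rewrite -(big_mkord xpredT F) -(big_mkord xpredT G).
have [kr|rk] := ltnP k r.
  rewrite [LHS]big_nat_cond [RHS]big_nat_cond !big1// => i /andP[/andP[_ ik] _].
    by rewrite /G ffact_small ?mulr0 ?mul0r//; lia.
  by rewrite /F f0 ?mul0r//; lia.
rewrite (@big_cat_nat _ _ _ r)//=; last by lia.
rewrite [X in X + _]big_nat_cond [X in X + _]big1 ?add0r => [|i]; last first.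
  by rewrite andbT => /andP[_ ir]; rewrite /F f0// mul0r.
rewrite [RHS](@big_cat_nat _ _ _ (k.+1 - r))//=; last by lia.
rewrite [X in _ = _ + X]big_nat_cond [X in _ = _ + X]big1 ?addr0 => [|i]; last first.
  by rewrite andbT => /andP[h1 h2]; rewrite /G ffact_small ?mulr0 ?mul0r//; lia.
rewrite -{1}[r]add0n big_addn [LHS]big_nat_cond [RHS]big_nat_cond; apply: eq_bigr => i.
rewrite andbT => /andP[_ hi]; rewrite /F /G mulrA.
by rewrite (_ : (k - (i + r) + r = k - i)%N)//; lia.
Qed.

Lemma diag_op_lower n : diag_op n = lower_op d (Ptilde Lambda a m n).
Proof.
apply/funext => x; apply/funext => k; rewrite /lower_op.
under eq_bigr => q _ do rewrite coef_Ptilde mulr_suml.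
rewrite exchange_big/= /diag_op big_seq [RHS]big_seq; apply: eq_bigr => p pL.
rewrite reindex_derivation; last by move=> i; exact: lead_low.
by rewrite mulr_sumr; apply: eq_bigr => q _; rewrite !mulrA.
Qed.

End Structure.

Lemma set_inj_setT (T U : Type) (f : T -> U) : set_inj [set: T] f -> injective f.
Proof. by move=> injf x y; apply: injf; rewrite in_setT. Qed.

(** * Both implications when all levels [zlevel] are nonnegative *)

Section PrincipalPart.
Variables (R : realType) (s : R).
Hypothesis s_ge0 : 0 <= s.
Variables (Lambda : {fset nat * nat}) (a : nat -> nat -> fps2 R) (m : nat).
Hypothesis a_conv : forall (p : nat * nat) i, p \in Lambda -> convergent (a p.1 p.2 i).
Hypothesis a_neq0 : forall (j r : nat), (j, r) \in Lambda -> a j r <> 0.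
Hypothesis m_max : is_max_weight Lambda a m%:Z.
Hypothesis zlevel_ge0 : forall p, p \in Lambda_m Lambda a m -> 0 <= zlevel a m p.

Local Notation T := (@pdo_int R Lambda a m).
Local Notation Pt := (Ptilde Lambda a m).

Let d : nat := (\max_(p <- Lambda) p.2).+1.
Local Notation L n := (lower_op d (Pt n)).

Let d_gt p : p \in Lambda_m Lambda a m -> (p.2 < d)%N.
Proof.
case/(mem_Lambda_m a_neq0) => pL _ _.
by rewrite ltnS (big_rem p)//= leq_maxl.
Qed.

Lemma lead_low p i : p \in Lambda_m Lambda a m -> (i < p.2)%N -> lead a m p i = 0.
Proof.
move=> pL ip; apply: contrapT => /ord_neq0[_ oi].
by have := zlevel_ge0 pL; rewrite /zlevel /alpha subr_ge0 lez_nat leqNgt (leq_ltn_trans oi ip).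
Qed.

Lemma PtildeE n j k : Pt n j k =
  \sum_(p <- Lambda_m Lambda a m | p.2 == j) (n ^_ (p.1 - m))%:R * lead a m p k.
Proof. by rewrite /Ptilde fct_sumE. Qed.

Lemma Ptilde_low n j k : (k < j)%N -> Pt n j k = 0.
Proof.
move=> kj; rewrite PtildeE big_seq_cond big1// => p /andP[pL /eqP pj].
by rewrite lead_low ?mulr0// pj.
Qed.

Lemma op_supp_Ptilde n j : op_supp (Pt n) j -> (j < d)%N.
Proof.
move=> bj; rewrite ltnNge; apply/negP => dj; apply: bj; apply/funext => k.
rewrite PtildeE big_seq_cond big1// => p /andP[/d_gt pd /eqP pj].
by move: pd; rewrite pj ltnNge dj.
Qed.

Lemma Ptilde_bound n : exists C B : R, [/\ 0 < C, 1 <= B &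
  forall j i, (j < d)%N -> nrm (Pt n j i) <= C * B ^+ i].
Proof.
apply: convergent_uniform => j _; rewrite /Ptilde big_seq_cond.
elim/big_ind: _ => [|u v|p /andP[/(mem_Lambda_m a_neq0)[pL _ _] _]].
- exact: convergent0.
- exact: convergentD.
- exact: convergentZ (a_conv _ _).
Qed.

Lemma op_height_Ptilde n j : op_supp (Pt n) j ->
  0 <= op_height (Pt n) j /\ Pt n j (`|op_height (Pt n) j| + j)%N <> 0.
Proof.
move=> bj; have [k bk] : exists k, Pt n j k <> 0.
  by apply: contrapT => /forallNP h; apply: bj; apply/funext => k; exact: contrapT (h k).
have [bo _] := ord_neq0 bk.
have jo : (j <= ord (Pt n j))%N.
  by rewrite leqNgt; apply/negP => oj; apply: bo; exact: Ptilde_low.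
by rewrite /op_height subzn// absz_nat subnK.
Qed.

Lemma op_height_le n j i : Pt n j (i + j)%N <> 0 ->
  op_supp (Pt n) j /\ op_height (Pt n) j <= i%:Z.
Proof.
move=> bij; split; first by move=> bj; apply: bij; rewrite bj.
by have [_ oi] := ord_neq0 bij; rewrite /op_height lerBlDr -PoszD lez_nat.
Qed.

Lemma T_triangular n u v : (forall i, (i < n)%N -> u i = v i) ->
  T u n - L n (u n) = T v n - L n (v n).
Proof.
move=> uv; rewrite -!(diag_op_lower d_gt lead_low).
exact: (pdo_int_tri m_max uv).
Qed.

Lemma T0 : T 0 = 0.
Proof.
have := linear_pdo_int Lambda a m 1 0 0; rewrite !scale1r addr0 => h.
by apply: (addrI (T 0)); rewrite -h addr0.
Qed.

Lemma T_gev u : seqs_in (gev s) u -> seqs_in (gev s) (T u).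
Proof.
move=> gu; apply: seqs_gev_pdo => //.
by apply: seqs_gev_iter => //; exact: seqs_gev_intt.
Qed.

(** L_n x is the coefficient of t^n in T(x t^n), so the stability under T is enough. *)
Lemma L_gev n x : gev s x -> gev s (L n x).
Proof.
move=> gx; pose w i : fps R := if i == n then x else 0.
have := @T_triangular n w 0; rewrite T0 /w eqxx.
rewrite -[(0 : fps2 R) n]/(0 : fps R) lower_op0 subr0 => /(_ _)/eqP.
rewrite subr_eq0 => h; rewrite -(eqP (h _)).
  by apply: T_gev => i; case: ifP => // _; exact: gev0.
by move=> i iN; rewrite ltn_eqF.
Qed.

Lemma lower_ordinate0P n : (exists2 j, op_supp (Pt n) j & op_height (Pt n) j = 0) ->
  is_lower_ordinate (Pt n) 0.
Proof.
move=> [j bj hj]; split; first by exists j.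
by move=> _ [i bi <-]; case: (op_height_Ptilde bi).
Qed.

Lemma max_height0 n : is_lower_ordinate (Pt n) 0 -> exists p, [/\ op_supp (Pt n) p,
  op_height (Pt n) p = 0 &
  forall j, op_supp (Pt n) j -> op_height (Pt n) j = 0 -> (j <= p)%N].
Proof.
move=> [[j0 bj0 hj0] _].
pose S j := `[< op_supp (Pt n) j /\ op_height (Pt n) j = 0 >].
have exS : exists j, S j by exists j0; exact/asboolP.
have ubS j : S j -> (j <= d)%N by move=> /asboolP[/op_supp_Ptilde/ltnW].
case: (ex_maxnP exS ubS) => p /asboolP[bp hp] maxp.
by exists p; split => // j bj hj; apply: maxp; exact/asboolP.
Qed.

(** The height belongs to the first monomial of the coefficient; later monomials have a larger i,
    which only weakens the inequality. *)
Lemma slope_coefP n p :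
  (forall j, op_supp (Pt n) j -> j%:R <= p%:R + s * (op_height (Pt n) j)%:~R) <->
  (forall j i, (j < d)%N -> Pt n j (i + j)%N <> 0 -> j%:R <= p%:R + s * i%:R).
Proof.
split=> h j => [i jd /op_height_le[bj hi]|bj].
  apply: le_trans (h j bj) _; rewrite lerD2l ler_wpM2l//.
  by rewrite -[i%:R]/(i%:Z%:~R) ler_int.
have [h0 bh] := op_height_Ptilde bj.
have := h j _ (op_supp_Ptilde bj) bh.
by rewrite -[X in s * X]/((`|op_height (Pt n) j|%N)%:Z%:~R) gez0_abs.
Qed.

Lemma condB_slope n p : is_lower_ordinate (Pt n) 0 -> op_supp (Pt n) p ->
  op_height (Pt n) p = 0 ->
  (forall j, op_supp (Pt n) j -> op_height (Pt n) j = 0 -> (j <= p)%N) ->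
  (inv_order s <= first_positive_slope (newton_polygon (Pt n)))%E <->
  (forall j i, (j < d)%N -> Pt n j (i + j)%N <> 0 -> j%:R <= p%:R + s * i%:R).
Proof.
move=> lo bp hp maxp; rewrite -slope_coefP.
by apply: (@first_positive_slopeP R (Pt n) s p d) => // j; exact: op_supp_Ptilde.
Qed.

Lemma height0P n j : op_supp (Pt n) j /\ op_height (Pt n) j = 0 <-> Pt n j j <> 0.
Proof.
split=> [[bj hj]|bj].
  by have [_] := op_height_Ptilde bj; rewrite hj.
have [|bj' hj] := @op_height_le n j 0; first by rewrite add0n.
by split => //; apply/eqP; rewrite eq_le hj; case: (op_height_Ptilde bj').
Qed.

(** At l = 0 condition (c) thus says that no diagonal entry of any L_n vanishes. Pairs of positive
    level do not contribute, as their leading coefficient has order in z above r. *)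
Lemma W_coef n k : W Lambda a m 0 n k 0%N = coef d (Pt n) 0 k.
Proof.
rewrite (coef_Ptilde d_gt) /W fct_sumE /Lambda_ml big_fset/= big_mkcond/=.
rewrite big_seq [RHS]big_seq; apply: eq_bigr => p pL; case: ifP => [/eqP zp|/negP zp].
  rewrite -[(_ *: _) 0%N]/((n ^_ (p.1 - m))%:R * (k ^_ p.2)%:R * lead_unit a m p 0%N).
  rewrite /lead_unit addn0 add0n.
  have -> : alpha a m p = p.2.
    by move: zp; rewrite /zlevel => /eqP; rewrite subr_eq0 eqz_nat => /eqP.
  by rewrite mulrAC.
rewrite add0n (_ : lead a m p p.2 = 0) ?mulr0 ?mul0r//.
apply: contrapT => /ord_neq0[_ ap]; apply: zp; rewrite eq_le zlevel_ge0// andbT.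
by rewrite /zlevel /alpha subr_le0 lez_nat.
Qed.

Lemma automorphism_sufficient : (forall n, is_lower_ordinate (Pt n) 0) ->
  condB Lambda a m s -> condC Lambda a m 0 -> automorphism_extends s Lambda a m.
Proof.
move=> lo cB cC.
have c0 n q : coef d (Pt n) 0 q <> 0 by rewrite -W_coef; exact: cC.
have bijL n := lower_op_bij (c0 n).
have bijLgev n : set_bij (gev s) (gev s) (L n).
  case: (bijL n) => _ injL surjL.
  have [p [bp hp maxp]] := max_height0 (lo n).
  have [C [B [C0 B1 hCB]]] := Ptilde_bound n.
  split; first exact: L_gev.
    by move=> x y _ _; exact: set_inj_setT.
  move=> f gf; have [w _ Lw] := surjL f Logic.I; exists w => //.
  apply: (@gev_lower_op_inv _ _ s_ge0 _ _ _ _ C0 B1 hCB p) => //.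
  - exact: op_supp_Ptilde bp.
  - exact: (height0P n p).1 (conj bp hp).
  - exact: (condB_slope (lo n) bp hp maxp).1 (cB n).
  - by rewrite Lw.
have linT := linear_pdo_int Lambda a m.
split; split => [c u v _ _|].
- exact: linT.
- rewrite (_ : setT = seqs_in [set: fps R]); last by apply/seteqP; split.
  exact: (@triangular_bij _ T (fun n => L n) T_triangular).
- exact: linT.
- rewrite gevrey_tE//; apply: (@triangular_bij _ T (fun n => L n) T_triangular) => //.
  + exact: gev0.
  + exact: gevB.
  + exact: T_gev.
Qed.

Lemma automorphism_necessary : automorphism_extends s Lambda a m ->
  [/\ forall n, is_lower_ordinate (Pt n) 0, condB Lambda a m s & condC Lambda a m 0].
Proof.
move=> [[_ [_ _ surjT]] [_ [_ _ surjTgev]]].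
have seqsT : setT = seqs_in [set: fps R] by apply/seteqP; split.
have L0 n : L n 0 = 0 by exact: lower_op0.
(* Nonzero diagonals for i < n make the earlier L_i injective; then surjectivity of T passes to L_n,
   which forces its own diagonal to be nonzero. *)
have c0 n : forall q, coef d (Pt n) 0 q <> 0.
  elim/ltn_ind: n => n IH; apply: lower_op_surj_coef.
  apply: (@triangular_diag_surj _ T (fun n => L n) T_triangular) => //; first exact: T0.
    by rewrite -seqsT.
  by move=> i /IH /lower_op_bij[_ injL _]; exact: set_inj_setT.
have surjL n : set_surj (gev s) (gev s) (L n).
  apply: (@triangular_diag_surj _ T (fun n => L n) T_triangular) => //; [exact: gev0|exact: T0| |].
    by rewrite -gevrey_tE.
  by move=> i _; have [_ injL _] := lower_op_bij (c0 i); exact: set_inj_setT.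
(* Without a coefficient of height 0 all the b_j(j) would vanish, and with them the diagonal entry
   at q = 0. *)
have lo n : is_lower_ordinate (Pt n) 0.
  apply: lower_ordinate0P; apply: contrapT => h; apply: (c0 n 0%N).
  rewrite /coef big1// => j _; rewrite add0n.
  have [->|/eqP/height0P[bj hj]] := eqVneq (Pt n j j) 0; first by rewrite mul0r.
  by case: h; exists j.
split => // [n|n k]; last by rewrite W_coef.
have [p [bp hp maxp]] := max_height0 (lo n).
have [C [B [C0 B1 hCB]]] := Ptilde_bound n.
apply/(condB_slope (lo n) bp hp maxp).
apply: (gev_surj_slope s_ge0 C0 B1 hCB (c0 n) _ (surjL n)) => j _ /height0P[bj hj].
exact: maxp.
Qed.

End PrincipalPart.

Theorem theorem4 (R : realType) (s : R) (s_ge0 : 0 <= s)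
    (Lambda : {fset nat * nat}) (Lambda_neq0 : Lambda != fset0)
    (a : nat -> nat -> fps2 R)
    (a_holo : forall j r, (j, r) \in Lambda -> holo_fps (a j r))
    (a_neq0 : forall j r, (j, r) \in Lambda -> a j r <> 0)
    (m : nat) (m_max : is_max_weight Lambda a m%:Z)
    (l : int) (l_min : is_min_zlevel Lambda a m l) :
  (condA Lambda a m l -> condB Lambda a m s -> condC Lambda a m l ->
     automorphism_extends s Lambda a m) /\
  (automorphism_extends s Lambda a m ->
     condA Lambda a m l \/ condC Lambda a m l ->
     [/\ condA Lambda a m l, condB Lambda a m s & condC Lambda a m l]).
Proof.
have a_conv (p : nat * nat) i : p \in Lambda -> convergent (a p.1 p.2 i).
  by move=> pL; apply: holo_fps_convergent; apply: a_holo; rewrite -surjective_pairing.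
case: l_min => [[p0 p0L zp0] lmin].
have zlevel_ge0 : 0 <= l -> forall p, p \in Lambda_m Lambda a m -> 0 <= zlevel a m p.
  by move=> l0 p pL; apply: le_trans l0 _; apply: lmin; exists p.
split=> [[lo l0] cB cC|aut AC].
  move: lo cC; rewrite l0 => lo cC.
  by apply: (automorphism_sufficient s_ge0 a_conv a_neq0 m_max) => //; apply: zlevel_ge0; rewrite l0.
(* Under (c), evaluate W at n = k = 0: only r = 0 survives in 0^_r, and then the level alpha - r is
   nonnegative, so a negative l would give W = 0. *)
have l_ge0 : 0 <= l.
  case: AC => [[_ ->]//|cC].
  apply: contrapT => /negP l_lt0; apply: (cC 0%N 0%N).
  rewrite /W fct_sumE big_seq big1// => p; rewrite /Lambda_ml !inE => /andP[_ /eqP zp].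
  rewrite (ffact0n p.2); have [p20|_] := eqVneq p.2 0%N; last by rewrite mulr0 scale0r.
  by move: l_lt0; rewrite -zp /zlevel p20 subr0.
have [lo cB cC] := automorphism_necessary s_ge0 a_conv a_neq0 m_max (zlevel_ge0 l_ge0) aut.
(* Here [cC] is (c) at level 0. If l were positive, no pair would have level 0, and the
   corresponding W would be an empty sum. *)
have l0 : l = 0.
  apply/eqP; rewrite eq_le l_ge0 andbT leNgt; apply/negP => l_gt0.
  apply: (cC 0%N 0%N); rewrite /W /Lambda_ml fct_sumE big_seq big1// => p.
  rewrite !inE => /andP[pL /eqP zp].
  have : l <= zlevel a m p by apply: lmin; exists p; rewrite //= !inE.
  by rewrite zp leNgt l_gt0.
by split; rewrite ?l0.
Qed.
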